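(* Let $\lambda>0$ and assume that $0<p-1<q$, $q>1$, and $\sigma\not\equiv 0$ on $\partial S$. Then the solution $u$ of the problem $$\begin{cases} u_t(x,t)=\Delta_{p,\omega}u(x,t)+\lambda|u(x,t)|^{q-1}u(x,t), & (x,t)\in S\times(0,\infty),\\ \mu(z)\frac{\partial u}{\partial_p n}(z,t)+\sigma(z)|u(z,t)|^{p-2}u(z,t)=0, & (z,t)\in\partial S\times[0,\infty),\\ u(x,0)=u_0(x)\ge 0, & x\in\overline S,\end{cases}$$ blows up in finite time $T>0$, provided that $$\max_{x\in S}u_0(x)>\left(\frac{\max_{x\in S}d_\omega x}{\lambda}\right)^{\frac{1}{q-p+1}}.$$
   Context: Network: $G=(V,E)$ is a finite, connected, simple graph with a weight $\omega:V\times V\to[0,\infty)$, i.e. $\omega(x,x)=0$, $\omega(x,y)=\omega(y,x)$, and $\omega(x,y)>0$ iff $x\sim y$ ($x,y$ adjacent). $S$ is a connected induced subgraph of $G$ (identified with its vertex set), $\partial S=\{z\in V\setminus S: y\sim z\text{ for some }y\in S\}$, and $\overline S=S\cup\partial S$ is the network whose edges are the edges of $G$ with at least one endpoint in $S$ (so there are no edges between two vertices of $\partial S$ in $\overline S$, and $\omega$ is regarded as $0$ there). The degree of $x\in\overline S$ is $d_\omega x=\sum_{y\in\overline S}\omega(x,y)$. Operators, for $u:\overline S\to\mathbb R$, with the convention $|a|^{p-2}a=0$ if $a=0$: $\Delta_{p,\omega}u(x)=\sum_{y\in\overline S}|u(x)-u(y)|^{p-2}[u(y)-u(x)]\omega(x,y)$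 for $x\in\overline S$, and $\frac{\partial u}{\partial_p n}(z)=\sum_{y\in S}|u(z)-u(y)|^{p-2}[u(z)-u(y)]\omega(z,y)$ for $z\in\partial S$. For functions of $(x,t)$ they act in the variable $x$. Boundary coefficients: $\mu,\sigma:\partial S\to[0,\infty)$ with $\mu(z)+\sigma(z)>0$ for all $z\in\partial S$. Solution: a function $u$ on $\overline S\times[0,T)$, $0<T\le\infty$, with $u(x,\cdot)$ continuous on $[0,T)$ and differentiable in $(0,T)$ for each $x\in\overline S$, satisfying the problem for times in $[0,T)$, where $[0,T)$ is a maximal interval of existence. The solution blows up in finite time $T$ $(0<T<\infty)$ if there exists $x\in S$ such that $|u(x,t)|\to+\infty$ as $t\nearrow T^-$ (the paper states this equivalently as $\sum_{x\in S}|u(x,t)|\to+\infty$ as $t\nearrow T^-$). *)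

(* Defs.v *)
From mathcomp Require Import all_boot all_order all_algebra.
From mathcomp Require Import all_classical all_reals all_analysis.

Set Implicit Arguments.
Unset Strict Implicit.
Unset Printing Implicit Defensive.

Import Order.TTheory GRing.Theory Num.Theory.
Import numFieldNormedType.Exports.

Local Open Scope classical_set_scope.
Local Open Scope ring_scope.

Record network (R : realType) (V : finType) := Network {
  adj : rel V;
  weight : V -> V -> R;
  adj_sym : symmetric adj;
  adj_irr : irreflexive adj;
  adj_connected : forall x y, connect adj x y;
  weight_ge0 : forall x y, 0 <= weight x y;
  weight_diag : forall x, weight x x = 0;
  weight_sym : forall x y, weight x y = weight y x;
  weight_gt0 : forall x y, (0 < weight x y) = adj x y
}.

(* The true maximum when A is nonempty and f is nonnegative on A. *)
Definition max_over (R : realType) (V : finType) (A : {set V}) (f : V -> R) : R :=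
  \big[Num.max/0]_(x in A) f x.

Section Operators.
Variables (R : realType) (V : finType) (G : network R V) (S : {set V}).

Definition connected_subgraph : Prop :=
  forall x y, x \in S -> y \in S ->
    connect [rel a b | [&& a \in S, b \in S & adj G a b]] x y.

Definition bdry : {set V} :=
  [set z | (z \notin S) && [exists y in S, adj G y z]]%SET.

Definition sbar : {set V} := (S :|: bdry)%SET.

(* The closed network has no edge between two boundary vertices. *)
Definition sbar_weight (x y : V) : R :=
  if (x \in S) || (y \in S) then weight G x y else 0.

Definition degree (x : V) : R := \sum_(y in sbar) sbar_weight x y.

(* [0 `^ r] is 0, or 1 when r = 0; in either case [`|a| `^ (p - 2) * a] is 0
   at a = 0, which is the usual convention, also for 1 < p < 2. *)
Definition p_laplacian (p : R) (u : V -> R) (x : V) : R :=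
  \sum_(y in sbar)
    `|u x - u y| `^ (p - 2) * (u y - u x) * sbar_weight x y.

Definition p_normal_derivative (p : R) (u : V -> R) (z : V) : R :=
  \sum_(y in S) `|u z - u y| `^ (p - 2) * (u z - u y) * sbar_weight z y.

(* A function on sbar x [0, T) is represented by a total [u : V -> R -> R],
   whose values outside sbar x [0, T) are irrelevant; T may be +oo. *)
Record is_solution (p q lambda : R) (mu sigma u0 : V -> R)
    (T : \bar R) (u : V -> R -> R) : Prop := IsSolution {
  sol_time_gt0 : (0 < T)%E;
  sol_continuous : forall x, x \in sbar ->
    {within [set t : R | 0 <= t /\ (t%:E < T)%E], continuous (u x)};
  sol_derivable : forall x, x \in sbar ->
    forall t : R, 0 < t -> (t%:E < T)%E -> derivable (u x) t 1;
  sol_equation : forall x, x \in S ->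
    forall t : R, 0 < t -> (t%:E < T)%E ->
      derive1 (u x) t = p_laplacian p (u ^~ t) x
                    + lambda * `|u x t| `^ (q - 1) * u x t;
  sol_boundary : forall z, z \in bdry ->
    forall t : R, 0 <= t -> (t%:E < T)%E ->
      mu z * p_normal_derivative p (u ^~ t) z
      + sigma z * `|u z t| `^ (p - 2) * u z t = 0;
  sol_initial : forall x, x \in sbar -> u x 0 = u0 x
}.

Definition is_maximal_solution (p q lambda : R) (mu sigma u0 : V -> R)
    (T : \bar R) (u : V -> R -> R) : Prop :=
  is_solution p q lambda mu sigma u0 T u /\
  forall (T' : \bar R) (v : V -> R -> R),
    is_solution p q lambda mu sigma u0 T' v ->
    (forall x, x \in sbar ->
      forall t : R, 0 <= t -> (t%:E < T)%E -> (t%:E < T')%E ->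
        v x t = u x t) ->
    (T' <= T)%E.

Definition blows_up_at (T : R) (u : V -> R -> R) : Prop :=
  0 < T /\ exists2 x, x \in S & `|u x t| @[t --> T^'-] --> +oo.

End Operators.

(* Main.v *)
Require Import Defs.
From mathcomp Require Import all_boot all_order all_algebra.
From mathcomp Require Import all_classical all_reals all_analysis.
From mathcomp Require Import ring lra.

Set Implicit Arguments.
Unset Strict Implicit.
Unset Printing Implicit Defensive.

Import Order.TTheory GRing.Theory Num.Theory.
Import numFieldNormedType.Exports.

Local Open Scope classical_set_scope.
Local Open Scope ring_scope.

(** Why the solution blows up.  Nonnegative data keep the solution nonnegative
    ([solution_ge0]): at a point where u is negative and minimal over the
    closed network the diffusion term is nonnegative and the reaction term is
    at least a constant multiple of u, so that u, rescaled by a suitable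
    exponential of time, cannot have decreased to this value; the boundary
    condition does not create a smaller value, because the boundary
    value is a nonlinear mean of 0 and of neighbouring values.  Once u >= 0,
    every difference u(y) - u(x) is at least - u(x), so that each interior
    vertex satisfies on its own the scalar inequality
      u' >= lambda u^q - D u^(p-1),   D the maximal degree
    ([solution_growth]).  Above the threshold (D / lambda)^(1/(q-p+1)) the right
    side dominates a multiple of u^q ([reaction_dominates]): a vertex above the
    threshold stays above its level ([solution_stays_above]) and, as q > 1,
    cannot live beyond a fixed time ([solution_lifetime]).  Hence T is finite.

    What is left is that a maximal solution with finite T is unbounded.  If it
    is unbounded at one vertex, then at that vertex it passes every level above
    the threshold, stays above it, and so tends to infinity
    ([unbounded_blows_up]).  A bounded solution, on the other hand, can be
    continued past T ([bounded_solution_extends]).  Three facts make the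
    continuation work.
    - The boundary values are a function of the interior values: they are the
      unique zero of an increasing function, here called the nonlinear mean
      [pmean].  The mean is nonexpansive in the sup norm.
    - Boundary values must be differentiable in time.  For p <> 2 the
      mean is in general not a differentiable function of its arguments, but it
      is differentiable along every differentiable curve ([pmean_derivable]),
      since its homogeneous blow-up at a point is again a mean.
    - For p < 2 the vector field is not Lipschitz, so local existence is
      Peano's theorem ([peano]): the Euler step functions converge pointwise
      along an ultrafilter, and equicontinuity passes to the limit. *)

(** * The odd power s |-> |s|^(p-2) s *)

Section OddPower.
Variable R : realType.
Implicit Types p s t : R.

Definition ppow p s : R := `|s| `^ (p - 2) * s.

Lemma ppow0 p : ppow p 0 = 0.
Proof. by rewrite /ppow mulr0. Qed.

Lemma ppowN p s : ppow p (- s) = - ppow p s.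
Proof. by rewrite /ppow normrN mulrN. Qed.

Lemma ppowM p s t : ppow p (s * t) = ppow p s * ppow p t.
Proof. by rewrite /ppow normrM powRM// mulrACA. Qed.

Lemma ppow_ge0E p s : 1 < p -> 0 <= s -> ppow p s = s `^ (p - 1).
Proof.
move=> p1; rewrite le_eqVlt => /predU1P[<-|s0].
  by rewrite ppow0 powR0// subr_eq0 gt_eqF.
have -> : p - 1 = 1 + (p - 2) by ring.
rewrite /ppow gtr0_norm// mulrC [RHS]powRD ?powRr1 ?(ltW s0)//.
by rewrite (gt_eqF s0) implybT.
Qed.

Lemma norm_ppow p s : 1 < p -> `|ppow p s| = `|s| `^ (p - 1).
Proof.
move=> p1; rewrite -ppow_ge0E// /ppow normrM.
by rewrite ger0_norm ?powR_ge0// normr_id.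
Qed.

Lemma ppow_lt p : 1 < p -> {homo ppow p : s t / s < t}.
Proof.
move=> p1; have pos s t : 0 <= s -> s < t -> ppow p s < ppow p t.
  move=> s0 st; rewrite !ppow_ge0E ?(ltW (le_lt_trans s0 st))//.
  by rewrite gt0_ltr_powR ?subr_gt0// nnegrE// (ltW (le_lt_trans s0 st)).
move=> s t st; have [s0|s0] := leP 0 s; first exact: pos.
have [t0|t0] := leP t 0.
  by rewrite -[s]opprK -[t]opprK !(ppowN p (- _)) ltrN2 pos ?oppr_ge0 ?ltrN2.
apply: (@lt_trans _ _ 0).
  by rewrite -[s]opprK ppowN oppr_lt0 -{1}(ppow0 p) pos ?oppr_gt0.
by rewrite -(ppow0 p) pos.
Qed.

Lemma ppow_le p : 1 < p -> {homo ppow p : s t / s <= t}.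
Proof. by move=> p1; apply: ltW_homo; exact: ppow_lt. Qed.

Lemma ppow_ge0 p s : 0 <= s -> 0 <= ppow p s.
Proof. by move=> s0; rewrite mulr_ge0 ?powR_ge0. Qed.

Lemma ppow_derive p s : 1 < p -> s != 0 ->
  is_derive s 1 (ppow p) ((p - 1) * `|s| `^ (p - 2)).
Proof.
move=> p1; have pos t : 0 < t -> is_derive t 1 (ppow p) ((p - 1) * t `^ (p - 2)).
  move=> t0; have := is_derive1_powR (p - 1) t0.
  have -> : p - 1 - 1 = p - 2 by ring.
  apply: near_eq_is_derive; near=> x; rewrite ppow_ge0E//; near: x.
  by apply: filterS (lt_nbhsr t0) => x /ltW.
rewrite neq_lt => /orP[s0|s0]; last by rewrite gtr0_norm//; exact: pos.
have -> : ppow p = - (ppow p \o -%R).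
  by apply/funext => x /=; rewrite !fctE /= ppowN opprK.
rewrite ltr0_norm//; set d := (X in is_derive _ _ _ X).
have -> : d = - (d * -1) by rewrite mulrN1 opprK.
apply: is_deriveN; apply: is_derive1_comp => //.
by apply: pos; rewrite oppr_gt0.
Unshelve. all: by end_near. Qed.

Lemma ppow_continuous p : 1 < p -> continuous (ppow p).
Proof.
move=> p1 s; have [->|s0] := eqVneq s 0; last first.
  apply: differentiable_continuous; apply/derivable1_diffP.
  by have [] := ppow_derive p1 s0.
rewrite /continuous_at ppow0; apply/cvgr0Pnorm_lt => e e0.
have d0 : 0 < e `^ (p - 1)^-1 by rewrite powR_gt0.
near=> x; have xd : `|x| < e `^ (p - 1)^-1 by near: x; exact: (@pseudometric_normed_Zmodule.nbhs0_lt R R _ d0).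
rewrite norm_ppow//; apply: lt_le_trans (_ : _ `^ (p - 1) <= _).
  by apply: gt0_ltr_powR xd; rewrite ?subr_gt0// nnegrE// ltW.
by rewrite -powRrM mulVf ?powRr1 ?(ltW e0)// gt_eqF// subr_gt0.
Unshelve. all: by end_near.
Qed.

Lemma ppow_cvg p (T : Type) (F : set_system T) {FF : Filter F} (f : T -> R) l :
  1 < p -> f x @[x --> F] --> l -> ppow p (f x) @[x --> F] --> ppow p l.
Proof.
by move=> p1; apply: (@continuous_cvg _ _ _ _ FF f); exact: ppow_continuous.
Qed.

Lemma cvg_sumr (I : finType) (P : pred I) (T : Type) (F : set_system T)
    {FF : Filter F} (f : I -> T -> R) (l : I -> R) :
  (forall i, P i -> f i x @[x --> F] --> l i) ->
  \sum_(i | P i) f i x @[x --> F] --> \sum_(i | P i) l i.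
Proof. by move=> fl; apply: cvg_big => //; exact: add_continuous. Qed.

Lemma norm_ppow_le p s t : 1 < p -> `|s| <= t -> `|ppow p s| <= ppow p t.
Proof.
by move=> p1; rewrite !ler_norml -ppowN => /andP[? ?]; rewrite !ppow_le.
Qed.

End OddPower.

(** * Nonlinear means *)

Section NonlinearMean.
Variables (R : realType) (I : finType).
Implicit Types (p m d K : R) (a y : I -> R).

Definition psum p a y m : R := \sum_i a i * ppow p (m - y i).

(** The minimiser of m |-> \sum_i a_i |m - y_i|^p.  It is characterised by the
    vanishing of the derivative, which is p times [psum]; this is how it enters
    the boundary condition. *)
Definition pmean p a y : R := xget 0 [set m | psum p a y m = 0].

Definition nontrivial_weight a : Prop :=
  (forall i, 0 <= a i) /\ exists i, 0 < a i.

(** Monotone in the differences m - y_i, hence in m and in each - y_i at once;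
    all order properties of the mean below come from this. *)
Lemma psum_lt p a y y' m m' : 1 < p -> nontrivial_weight a ->
  (forall i, m - y i < m' - y' i) -> psum p a y m < psum p a y' m'.
Proof.
move=> p1 [a0 [j aj]] h; rewrite /psum (bigD1 j)//= [ltRHS](bigD1 j)//=.
apply: ltr_leD; first by rewrite ltr_pM2l// ppow_lt.
by apply: ler_sum => i _; rewrite ler_wpM2l ?a0// ppow_le// ltW.
Qed.

Lemma psum_continuous p a y : 1 < p -> continuous (psum p a y).
Proof.
move=> p1 m; apply: cvg_sumr => i _; apply: cvgM; first exact: cvg_cst.
by apply: ppow_cvg => //; apply: cvgB; [exact: cvg_id|exact: cvg_cst].
Qed.

Lemma psum_pmean p a y : 1 < p -> nontrivial_weight a ->
  psum p a y (pmean p a y) = 0.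
Proof.
move=> p1 wa; suff [m m0] : exists m, psum p a y m = 0.
  by apply: (@xgetPex _ 0 [set m | psum p a y m = 0]); exists m.
have [a0 _] := wa; pose K := \sum_i `|y i|.
have yK i : `|y i| <= K.
  by rewrite /K (bigD1 i)//= lerDl sumr_ge0.
have K0 : 0 <= K by rewrite sumr_ge0.
have NKK : - K <= K by lra.
have lo : psum p a y (- K) <= 0.
  rewrite /psum -oppr_ge0 -sumrN sumr_ge0// => i _.
  rewrite -mulrN -ppowN mulr_ge0 ?a0// ppow_ge0//.
  by have := yK i; rewrite ler_norml => /andP[? ?]; lra.
have hi : 0 <= psum p a y K.
  rewrite /psum sumr_ge0// => i _; rewrite mulr_ge0 ?a0// ppow_ge0//.
  by have := yK i; rewrite ler_norml => /andP[? ?]; lra.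
(* [psum] is <= 0 at - K and >= 0 at K as all entries lie in [- K, K]. *)
have cts : {within `[- K, K], continuous (psum p a y)}.
  by apply: continuous_subspaceT; exact: psum_continuous.
have [|m _ m0] := IVT (v := 0) NKK cts; last by exists m.
by rewrite ge_min lo le_max hi orbT.
Qed.

Lemma psum_mono p a y m m' : 1 < p -> nontrivial_weight a ->
  (psum p a y m < psum p a y m') = (m < m').
Proof.
move=> p1 wa; have [mm'|mm'|->] := ltgtP m m'; last by rewrite ltxx.
  by rewrite psum_lt// => i; rewrite ltrD2r.
by apply/negbTE; rewrite -leNgt ltW// psum_lt// => i; rewrite ltrD2r.
Qed.

Lemma pmeanP p a y m : 1 < p -> nontrivial_weight a ->
  psum p a y m = 0 -> pmean p a y = m.
Proof.
move=> p1 wa m0; have z0 := psum_pmean y p1 wa.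
have [lt|lt|//] := ltgtP (pmean p a y) m;
  by move: lt; rewrite -(psum_mono y _ _ p1 wa) z0 m0 ltxx.
Qed.

(** Raising all entries by d raises the mean by d, so monotonicity gives
    nonexpansiveness in the sup norm. *)
Lemma pmean_dist p a y y' d : 1 < p -> nontrivial_weight a ->
  (forall i, `|y i - y' i| <= d) -> `|pmean p a y - pmean p a y'| <= d.
Proof.
move=> p1 wa.
have le1 z z' : (forall i, `|z i - z' i| <= d) -> pmean p a z - pmean p a z' <= d.
  move=> zz'; rewrite leNgt; apply/negP => dz.
  have : psum p a z' (pmean p a z') < psum p a z (pmean p a z).
    apply: psum_lt => // i.
    by have := zz' i; rewrite ler_norml => /andP[? ?]; lra.
  by rewrite !psum_pmean// ltxx.
move=> yy'; rewrite ler_norml le1// andbT lerNl opprB le1// => i.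
by rewrite distrC.
Qed.

Lemma pmean0 p a : 1 < p -> nontrivial_weight a -> pmean p a (fun=> 0) = 0.
Proof.
move=> p1 wa; apply: pmeanP => //; rewrite /psum big1// => i _.
by rewrite subrr ppow0 mulr0.
Qed.

Lemma pmean_norm p a y K : 1 < p -> nontrivial_weight a ->
  (forall i, `|y i| <= K) -> `|pmean p a y| <= K.
Proof.
move=> p1 wa yK; rewrite -[pmean p a y]subr0 -(pmean0 p1 wa).
by apply: pmean_dist => // i; rewrite subr0.
Qed.

Lemma pmean_ge p a y c : 1 < p -> nontrivial_weight a ->
  (forall i, c <= y i) -> c <= pmean p a y.
Proof.
move=> p1 wa cy; rewrite leNgt; apply/negP => mc.
have : psum p a y (pmean p a y) < psum p a (fun=> 0) 0.
  by apply: psum_lt => // i; rewrite subr0 subr_lt0 (lt_le_trans mc).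
rewrite psum_pmean// -[X in psum _ _ _ X](pmean0 p1 wa) psum_pmean//.
by rewrite ltxx.
Qed.

End NonlinearMean.

(** * Differentiability of the mean along a curve *)

Section MeanAlongCurve.
Variables (R : realType) (I : finType).
Implicit Types (p r s h k : R) (a b v : I -> R).

Lemma quotient_cvg_derivable (f : R -> R) (t l : R) :
  h^-1 * (f (h + t) - f t) @[h --> 0^'] --> l -> derivable f t 1.
Proof.
move=> fl; apply/cvg_ex; exists l; apply: cvg_trans fl; apply: near_eq_cvg.
by near=> h; rewrite /= /GRing.scale/= mulr1.
Unshelve. all: by end_near. Qed.

Lemma derivable_quotient_cvg (f : R -> R) (t : R) : derivable f t 1 ->
  h^-1 * (f (h + t) - f t) @[h --> 0^'] --> derive1 f t.
Proof.
move=> ft; rewrite derive1E; apply: cvg_trans ft; apply: near_eq_cvg.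
by near=> h; rewrite /= /GRing.scale/= mulr1.
Unshelve. all: by end_near. Qed.

(** The difference quotient zeta(h) of the mean solves
      \sum_i a_i (ppow p (s_i + h (zeta - w_i(h))) - ppow p s_i) = 0,
    where w_i(h) is the difference quotient of the i-th entry.  If this sum,
    divided by h and rescaled by N(h) > 0, converges termwise to a sum of the
    same kind with exponent r and weights b, then zeta(h) converges to the mean
    of the velocities.  Strict monotonicity of the limit sum localises zeta(h)
    by its sign at c + e/2 and c - e/2, so no compactness is needed. *)
Lemma mean_quotient_cvg p r a b v (y : R -> I -> R) (t : R) (N : R -> R) :
  1 < p -> 1 < r -> nontrivial_weight a -> nontrivial_weight b ->
  (forall i, h^-1 * (y (h + t) i - y t i) @[h --> 0^'] --> v i) ->
  (\forall h \near 0^', 0 < N h) ->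
  (forall i k, let s := pmean p a (y t) - y t i in
     N h * (a i * ((ppow p (s + h * k) - ppow p s) / h)) @[h --> 0^']
       --> b i * ppow r k) ->
  h^-1 * (pmean p a (y (h + t)) - pmean p a (y t)) @[h --> 0^']
    --> pmean r b v.
Proof.
move=> p1 r1 wa wb yv N0 term; set c := pmean r b v.
pose s i := pmean p a (y t) - y t i.
pose zeta h := h^-1 * (pmean p a (y (h + t)) - pmean p a (y t)).
pose w i h := h^-1 * (y (h + t) i - y t i).
pose X k h := psum p a (fun i => - (s i + h * (k - v i))) 0.
pose Q k h := \sum_i N h * (a i * ((ppow p (s i + h * (k - v i)) - ppow p (s i)) / h)).
have QE k h : Q k h = N h / h * X k h.
  have s0 : \sum_i a i * ppow p (s i) = 0 by exact: (psum_pmean (y t) p1 wa).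
  rewrite -[X k h]subr0 -s0 /X /psum -sumrB mulr_sumr; apply: eq_bigr => i _.
  by rewrite sub0r opprK -mulrBr; ring.
have Qcvg k : Q k h @[h --> 0^'] --> psum r b v k.
  by apply: cvg_sumr => i _; exact: term.
have mE h i : h != 0 -> pmean p a (y (h + t)) - y (h + t) i
    = s i + h * (zeta h - w i h).
  by move=> h0; rewrite /s /zeta /w -mulrBr mulVKf//; ring.
(* The two signs of h are treated apart: multiplication by h < 0 reverses the
   order of the arguments of [psum], and the division by h reverses it back. *)
have above k h : h != 0 -> 0 < N h -> (forall i, k - v i < zeta h - w i h) ->
    Q k h < 0.
  move=> h0 Nh0 kz; rewrite QE.
  have Z := psum_pmean (y (h + t)) p1 wa.
  move: h0; rewrite neq_lt => /orP[h0|h0].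
    rewrite nmulr_rlt0 ?nmulr_llt0 ?invr_lt0// -Z; apply: psum_lt => // i.
    by rewrite mE ?lt_eqF// sub0r opprK ltrD2l ltr_nM2l.
  rewrite pmulr_rlt0 ?divr_gt0// -Z; apply: psum_lt => // i.
  by rewrite mE ?gt_eqF// sub0r opprK ltrD2l ltr_pM2l.
have below k h : h != 0 -> 0 < N h -> (forall i, zeta h - w i h < k - v i) ->
    0 < Q k h.
  move=> h0 Nh0 kz; rewrite QE.
  have Z := psum_pmean (y (h + t)) p1 wa.
  move: h0; rewrite neq_lt => /orP[h0|h0].
    rewrite nmulr_rgt0 ?nmulr_llt0 ?invr_lt0// -Z; apply: psum_lt => // i.
    by rewrite mE ?lt_eqF// sub0r opprK ltrD2l ltr_nM2l.
  rewrite pmulr_rgt0 ?divr_gt0// -Z; apply: psum_lt => // i.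
  by rewrite mE ?gt_eqF// sub0r opprK ltrD2l ltr_pM2l.
have c0 : psum r b v c = 0 by exact: psum_pmean.
apply/cvgrPdist_le => e e0.
have e2 : 0 < e / 2 by rewrite divr_gt0.
have hi : 0 < psum r b v (c + e / 2) by rewrite -c0 psum_mono// ltrDl.
have lo : psum r b v (c - e / 2) < 0 by rewrite -[ltRHS]c0 psum_mono// gtrBl.
near=> h.
have h0 : h != 0 by near: h; exact: nbhs_dnbhs_neq.
have Nh : 0 < N h by near: h.
have wv i : `|v i - w i h| < e / 2.
  move: i; near: h; apply: filter_forall => i.
  by move/cvgrPdist_lt : (yv i); apply.
have Qhi : 0 < Q (c + e / 2) h by near: h; move/cvgr_gt : (Qcvg (c + e / 2)); apply.
have Qlo : Q (c - e / 2) h < 0 by near: h; move/cvgr_lt : (Qcvg (c - e / 2)); apply.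
rewrite -/(zeta h) ler_norml; apply/andP; split; rewrite leNgt; apply/negP => ez.
  suff: Q (c + e / 2) h < 0 by rewrite ltNge ltW.
  by apply: above => // i; have := wv i; rewrite ltr_norml => /andP[? ?]; lra.
suff: 0 < Q (c - e / 2) h by rewrite ltNge ltW.
by apply: below => // i; have := wv i; rewrite ltr_norml => /andP[? ?]; lra.
Unshelve. all: by end_near. Qed.

Lemma norm_powR_cvg0 (e : R) : 0 < e -> `|h| `^ e @[h --> (0 : R)^'] --> (0 : R).
Proof.
move=> e0; have e1 : 1 < e + 1 by lra.
have : `|ppow (e + 1) h| @[h --> (0 : R)^'] --> `|ppow (e + 1) (0 : R)|.
  by apply: cvg_norm; apply: ppow_cvg => //; exact: nbhs_dnbhs.
rewrite ppow0 normr0; apply: cvg_trans; apply: near_eq_cvg.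
by near=> h; rewrite norm_ppow// addrK.
Unshelve. all: by end_near. Qed.

Lemma ppow_quotient_cvg p s k : 1 < p -> s != 0 ->
  (ppow p (s + h * k) - ppow p s) / h @[h --> 0^']
    --> (p - 1) * `|s| `^ (p - 2) * k.
Proof.
move=> p1 s0.
have D : is_derive (0 : R) 1 (ppow p \o (fun h => s + h * k))
    ((p - 1) * `|s| `^ (p - 2) * k).
  apply: is_derive1_comp; first by rewrite mul0r addr0; exact: ppow_derive.
  have -> : (fun h => s + h * k) = cst s + k \*: id.
    by apply/funext => h; rewrite fctE /= [k *: h]mulrC.
  by apply: is_derive_eq; rewrite add0r [k *: 1]mulr1.
have [D1 D2] := D; rewrite -D2 -derive1E.
apply: cvg_trans (derivable_quotient_cvg D1); apply: near_eq_cvg.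
by near=> h; rewrite /= addr0 mul0r addr0 mulrC.
Unshelve. all: by end_near. Qed.

Lemma ppow_quotient0 p h k : h != 0 ->
  (ppow p (0 + h * k) - ppow p 0) / h = `|h| `^ (p - 2) * ppow p k.
Proof.
by move=> h0; rewrite add0r ppow0 subr0 ppowM [ppow p h]/ppow; field.
Qed.

(** Two regimes occur as h tends to 0.  The entries that coincide with the mean
    (s_i = 0) contribute |h|^(p-2) ppow p k, the others contribute their
    derivative, linear in k.  If an entry of positive weight coincides with the
    mean and either p < 2 or all entries of positive weight do, the first kind
    dominates and the mean moves with the p-mean of the velocities; otherwise
    the second kind matters and it moves with a weighted average of them, that
    is, a 2-mean. *)
Lemma pmean_derivable p a (y : R -> I -> R) (t : R) :
  1 < p -> nontrivial_weight a -> (forall i, derivable (y ^~ i) t 1) ->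
  derivable (fun x => pmean p a (y x)) t 1.
Proof.
move=> p1 wa dy; pose v i := derive1 (y ^~ i) t.
have yv i : h^-1 * (y (h + t) i - y t i) @[h --> 0^'] --> v i.
  exact: derivable_quotient_cvg.
have [a0 [j aj]] := wa.
pose s i := pmean p a (y t) - y t i.
have [[p2 [i0 [si0 ai0]]]|] := pselect ((p < 2 \/ forall i, s i != 0 -> a i = 0)
    /\ exists i, s i = 0 /\ 0 < a i).
  (* First regime: rescale by |h|^(2-p), which keeps exactly the entries
     coinciding with the mean. *)
  pose b i := if s i == 0 then a i else 0.
  have wb : nontrivial_weight b.
    split; first by move=> i; rewrite /b; case: ifP.
    by exists i0; rewrite /b si0 eqxx.
  apply: quotient_cvg_derivable.
  apply: (@mean_quotient_cvg p p a b v y t (fun h => `|h| `^ (2 - p))) => //.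
    near=> h; rewrite powR_gt0// normr_gt0; near: h; exact: nbhs_dnbhs_neq.
  move=> i k /=; rewrite -/(s i) /b; have [->|sn0] := eqVneq (s i) 0.
    apply: (@cvg_trans _ (cst (a i * ppow p k) @ (0 : R)^')); last exact: cvg_cst.
    apply: near_eq_cvg.
    near=> h; have h0 : h != 0 by near: h; exact: nbhs_dnbhs_neq.
    rewrite /= ppow_quotient0// [RHS]mulrCA; congr (_ * _).
    rewrite mulrA -powRD ?normr_eq0 ?h0 ?implybT//.
    by rewrite addrA subrK subrr powRr0 mul1r.
  case: p2 => [p2|p2].
    rewrite mul0r -[X in _ --> X](mul0r (a i * ((p - 1) * `|s i| `^ (p - 2) * k))).
    apply: cvgM; first by apply: norm_powR_cvg0; rewrite subr_gt0.
    by apply: cvgM; [exact: cvg_cst|exact: ppow_quotient_cvg].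
  apply: (@cvg_trans _ (cst 0 @ (0 : R)^')); last by rewrite mul0r; exact: cvg_cst.
  by apply: near_eq_cvg; near=> h; rewrite p2// mul0r mulr0.
move=> H.
(* Second regime: no rescaling.  For p = 2 the entries with s_i = 0 are of the
   same order as the others and keep their weight. *)
pose b i := if s i == 0 then if p == 2 then a i else 0
            else a i * ((p - 1) * `|s i| `^ (p - 2)).
have bn0 i : s i != 0 -> 0 < a i -> 0 < b i.
  move=> si ai; rewrite /b (negbTE si) !mulr_gt0 ?subr_gt0 ?powR_gt0//.
  by rewrite normr_gt0.
have wb : nontrivial_weight b.
  split.
    move=> i; rewrite /b; case: ifP => _; first by case: ifP.
    by rewrite !mulr_ge0 ?powR_ge0// subr_ge0 ltW.
  have [[i [si ai]]|Hj] := pselect (exists i, s i != 0 /\ 0 < a i).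
    by exists i; exact: bn0.
  exfalso; apply: H; split.
    right => i si; apply/eqP; move: (a0 i); rewrite le_eqVlt eq_sym.
    by case/orP => // ai; exfalso; apply: Hj; exists i.
  by exists j; split=> //; apply/eqP/negP => /negP sj; apply: Hj; exists j.
apply: quotient_cvg_derivable.
apply: (@mean_quotient_cvg p 2 a b v y t (fun=> 1)) => //.
  by rewrite ltr1n.
  by near=> h.
move=> i k /=; rewrite -/(s i) /b.
have -> : ppow 2 k = k by rewrite /ppow subrr powRr0 mul1r.
rewrite -[X in _ --> X]mul1r; apply: cvgM; first exact: cvg_cst.
have [si0|sn0] := eqVneq (s i) 0; last first.
  by rewrite -mulrA; apply: cvgM; [exact: cvg_cst|exact: ppow_quotient_cvg].
rewrite si0; have [ai|ai] := eqVneq (a i) 0.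
  have -> : (if p == 2 then a i else 0) = 0 by rewrite ai; case: ifP.
  apply: (@cvg_trans _ (cst 0 @ (0 : R)^')); last by rewrite mul0r; exact: cvg_cst.
  by apply: near_eq_cvg; near=> h; rewrite ai mul0r.
have ai0 : 0 < a i by rewrite lt_def ai a0.
have p2 : 2 <= p.
  rewrite leNgt; apply/negP => p2; apply: H; split; first by left.
  by exists i; split.
apply: (@cvg_trans _ (a i * (`|h| `^ (p - 2) * ppow p k) @[h --> (0 : R)^'])).
  apply: near_eq_cvg; near=> h.
  have h0 : h != 0 by near: h; exact: nbhs_dnbhs_neq.
  by rewrite ppow_quotient0.
have [->|pn2] := eqVneq p 2.
  apply: (@cvg_trans _ (cst (a i * k) @ (0 : R)^')); last exact: cvg_cst.
  by apply: near_eq_cvg; near=> h; rewrite /ppow subrr !powRr0 !mul1r.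
have -> : 0 * k = a i * (0 * ppow p k) by rewrite !mul0r mulr0.
apply: cvgM; first exact: cvg_cst.
apply: cvgM; last exact: cvg_cst.
by apply: norm_powR_cvg0; rewrite subr_gt0 lt_def pn2.
Unshelve. all: by end_near. Qed.

End MeanAlongCurve.

(** * Peano's existence theorem *)

Section Peano.
Variables (R : realType) (I : finType).
Implicit Types (e d s t r : R) (w a : I -> R) (i j : I).

(** Continuity of each component for the sup norm on [I -> R], in epsilon-delta
    form. *)
Definition pointwise_continuous (F : (I -> R) -> I -> R) : Prop :=
  forall w i e, 0 < e -> exists2 d, 0 < d &
    forall w', (forall j, `|w' j - w j| < d) -> `|F w' i - F w i| < e.

Lemma seq_pointwise_continuous (F : (I -> R) -> I -> R) :
  (forall (w_ : nat -> I -> R) w, (forall j, w_ n j @[n --> \oo] --> w j) ->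
     forall i, F (w_ n) i @[n --> \oo] --> F w i) -> pointwise_continuous F.
Proof.
move=> cF w i e e0; apply: contrapT => H.
have /choice[w_ Hw] n : exists w', (forall j, `|w' j - w j| < n.+1%:R^-1) /\
    e <= `|F w' i - F w i|.
  apply: contrapT => Hn; apply: H; exists n.+1%:R^-1; first by rewrite invr_gt0.
  move=> w' ww'; rewrite ltNge; apply/negP => Fe; apply: Hn.
  by exists w'.
have ww j : w_ n j @[n --> \oo] --> w j.
  apply/cvgrPdist_lt => d d0.
  have : n.+1%:R^-1 @[n --> \oo] --> (0 : R) by exact: cvg_harmonic.
  move/cvgr_lt => /(_ d d0); apply: filterS => n nd.
  by rewrite distrC; apply: lt_trans nd; exact: (Hw n).1.
have /cvgrPdist_lt/(_ e e0) := cF w_ w ww i.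
move/filter_ex => [n]; rewrite distrC ltNge => /negP; apply.
exact: (Hw n).2.
Qed.

Variables (F : (I -> R) -> I -> R) (L : R) (a : I -> R).
Hypothesis F_bounded : forall w i, `|F w i| <= L.
Hypothesis F_continuous : pointwise_continuous F.

Let step n : R := n.+1%:R^-1.

Fixpoint euler n k : I -> R :=
  if k is k'.+1 then fun i => euler n k' i + step n * F (euler n k') i else a.

(** The Euler scheme of step 1/(n+1) read as a step function of time: no
    interpolation is needed, since only pointwise limits are taken. *)
Definition euler_fun n t : I -> R := euler n (Num.truncn (t * n.+1%:R)).

Lemma step_gt0 n : 0 < step n. Proof. by rewrite invr_gt0 ltr0n. Qed.

Lemma L_ge0 i : 0 <= L.
Proof. exact: le_trans (F_bounded a i). Qed.

(** Every step of the scheme adds h times a value of F within e of c. *)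
Lemma euler_increment n k m i c e : (k <= m)%N ->
  (forall l, (k <= l < m)%N -> `|F (euler n l) i - c| <= e) ->
  `|euler n m i - euler n k i - (m%:R - k%:R) * step n * c|
    <= (m%:R - k%:R) * step n * e.
Proof.
elim: m => [|m IH] km Fc.
  by move: km; rewrite leqn0 => /eqP ->; rewrite !subrr !mul0r subr0 normr0.
move: km; rewrite leq_eqVlt => /predU1P[->|km].
  by rewrite !subrr !mul0r subr0 normr0.
have {}IH : `|euler n m i - euler n k i - (m%:R - k%:R) * step n * c|
    <= (m%:R - k%:R) * step n * e.
  by apply: IH => // l /andP[kl lm]; apply: Fc; rewrite kl ltnW.
have Fm : `|F (euler n m) i - c| <= e by apply: Fc; rewrite ltnSn andbT.
have h0 := step_gt0 n.
have {}Fm : `|step n * (F (euler n m) i - c)| <= step n * e.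
  by rewrite normrM gtr0_norm// ler_pM2l.
rewrite /= -natr1.
have -> : euler n m i + step n * F (euler n m) i - euler n k i
    - (m%:R + 1 - k%:R) * step n * c
  = (euler n m i - euler n k i - (m%:R - k%:R) * step n * c)
    + step n * (F (euler n m) i - c) by ring.
have -> : (m%:R + 1 - k%:R) * step n * e
  = (m%:R - k%:R) * step n * e + step n * e by ring.
exact: le_trans (ler_normD _ _) (lerD IH Fm).
Qed.

Lemma euler_lipschitz n k m i :
  `|euler n m i - euler n k i| <= L * `|m%:R * step n - k%:R * step n|.
Proof.
wlog km : k m / (k <= m)%N.
  by move=> H; have [/H//|/ltnW/H] := leqP k m; rewrite distrC [in X in _ * X]distrC.
have nn : 0 <= (m%:R - k%:R) * step n.
  by rewrite mulr_ge0 ?subr_ge0 ?ler_nat// ltW// step_gt0.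
have := @euler_increment n k m i 0 L km; rewrite mulr0 subr0 -mulrBl => H.
rewrite (ger0_norm nn) mulrC.
by apply: H => l _; rewrite subr0.
Qed.

Lemma truncn_step n t : 0 <= t ->
  (Num.truncn (t * n.+1%:R))%:R * step n <= t
    < (Num.truncn (t * n.+1%:R))%:R * step n + step n.
Proof.
move=> t0; have := truncn_itv (mulr_ge0 t0 (ler0n R n.+1)).
move: (Num.truncn _) => k /andP[kt tk].
have -> : k%:R * step n + step n = k.+1%:R / n.+1%:R.
  by rewrite -natr1 mulrDl mul1r.
by rewrite /step ler_pdivrMr ?ltr0n// ltr_pdivlMr ?ltr0n// kt tk.
Qed.

Lemma euler_fun_lipschitz n s t i : 0 <= s -> 0 <= t ->
  `|euler_fun n t i - euler_fun n s i| <= L * (`|t - s| + step n).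
Proof.
move=> s0 t0; apply: le_trans (euler_lipschitz _ _ _ _) _.
rewrite ler_wpM2l ?(L_ge0 i)//.
have := truncn_step n s0; have := truncn_step n t0.
move: (_ * step n) (_ * step n) => x y /andP[? ?] /andP[? ?].
by rewrite ler_norml; have [?|?] := leP 0 (t - s);
  [rewrite ger0_norm// | rewrite ltr0_norm//]; apply/andP; split; lra.
Qed.

Lemma euler_fun_increment n s t i c e : 0 <= s -> s <= t -> 0 <= e -> `|c| <= L ->
  (forall l, (Num.truncn (s * n.+1%:R) <= l < Num.truncn (t * n.+1%:R))%N ->
     `|F (euler n l) i - c| <= e) ->
  `|euler_fun n t i - euler_fun n s i - (t - s) * c|
    <= (t - s) * e + step n * (e + L).
Proof.
move=> s0 st e0 cL Fc; have t0 := le_trans s0 st.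
have km : (Num.truncn (s * n.+1%:R) <= Num.truncn (t * n.+1%:R))%N.
  by apply: le_truncn; rewrite ler_wpM2r.
have := euler_increment km Fc; rewrite -/(euler_fun n s) -/(euler_fun n t).
rewrite (mulrBl (step n)).
have := truncn_step n s0; have := truncn_step n t0.
set x := (Num.truncn (t * _))%:R * step n.
set y := (Num.truncn (s * _))%:R * step n => /andP[xt tx] /andP[ys sy] H.
have -> : euler_fun n t i - euler_fun n s i - (t - s) * c =
  (euler_fun n t i - euler_fun n s i - (x - y) * c) + (x - y - (t - s)) * c by ring.
have xy : `|x - y - (t - s)| <= step n.
  by rewrite ler_norml; apply/andP; split; lra.
have /(le_trans _) : (x - y) * e + step n * L <= (t - s) * e + step n * (e + L).
  rewrite mulrDr addrA lerD2r -mulrDl ler_wpM2r//; lra.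
apply; apply: le_trans (ler_normD _ _) (lerD H _).
by rewrite normrM ler_pM.
Qed.

(** Ultrafilter limits replace the extraction of a subsequence, with all times
    and all components handled at once. *)
Lemma bounded_ultra_cvg (G : set_system nat) (f : nat -> R) (K : R) :
  UltraFilter G -> (forall n, `|f n| <= K) -> exists l : R, f n @[n --> G] --> l.
Proof.
move=> UG fK; have := @segment_compact R (- K) K.
move=> /(_ (f @ G) _) [|l [_ cl]].
  by apply: (@filterE _ G) => n /=; rewrite in_itv/= -ler_norml fK.
exists l => B Bl; have [//|GB] := in_ultra_setVsetC (f @^-1` B) UG.
by have [x []] := cl (~` B) B GB Bl.
Qed.

(** The last clause is strict differentiability of the limit with derivative
    F (w r): increments over [s, t] near r are (t - s) F (w r) up to e (t - s).
    It contains the right derivative at r = 0 and, unlike an integral equation,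
    passes to pointwise limits directly.  Near r all points visited by the n-th
    scheme are within d0 of w r, by the common Lipschitz bound. *)
Theorem peano : exists w : R -> I -> R,
  [/\ w 0 = a,
   forall s t i, 0 <= s -> 0 <= t -> `|w t i - w s i| <= L * `|t - s| &
   forall r i e, 0 <= r -> 0 < e -> exists2 d, 0 < d & forall s t,
     0 <= s -> s <= t -> `|s - r| < d -> `|t - r| < d ->
     `|w t i - w s i - (t - s) * F (w r) i| <= e * (t - s)].
Proof.
have [G [UG oG]] := @ultraFilterLemma nat \oo _.
have PG : ProperFilter G by exact: ultra_proper.
have step0 : step n @[n --> G] --> (0 : R).
  by move=> B /cvg_harmonic /oG.
have bnd t i : 0 <= t -> forall n, `|euler_fun n t i| <= `|a i| + L * (t + 1).
  move=> t0 n; have := euler_fun_lipschitz n i (lexx 0) t0.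
  rewrite {2}/euler_fun mul0r truncn0 /= subr0 (ger0_norm t0) => H.
  have -> : euler_fun n t i = a i + (euler_fun n t i - a i) by ring.
  apply: le_trans (ler_normD _ _) (lerD (lexx _) (le_trans H _)).
  by rewrite ler_wpM2l ?(L_ge0 i)// lerD2l invf_le1 ?ler1n ?ltr0n.
pose w t i := if 0 <= t then lim (euler_fun n t i @[n --> G]) else 0.
have wcvg t i : 0 <= t -> euler_fun n t i @[n --> G] --> w t i.
  move=> t0; rewrite /w t0; have [l fl] := bounded_ultra_cvg UG (bnd t i t0).
  by apply/cvg_ex; exists l.
exists w; split.
- apply/funext => i; apply: (@cvg_unique _ _ (euler_fun n 0 i @[n --> G])).
  + exact: norm_hausdorff.
  + exact: wcvg.
  + apply: (@cvg_trans _ (cst (a i) @ G)); last exact: cvg_cst.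
    by apply: near_eq_cvg; near=> n; rewrite /euler_fun mul0r truncn0.
- move=> s t i s0 t0.
  have H1 : `|euler_fun n t i - euler_fun n s i| @[n --> G] --> `|w t i - w s i|.
    by apply: cvg_norm; apply: cvgB; exact: wcvg.
  have H2 : L * (`|t - s| + step n) @[n --> G] --> L * (`|t - s| + 0).
    by apply: cvgM; [exact: cvg_cst|apply: cvgD; [exact: cvg_cst|]].
  rewrite addr0 in H2; apply: ler_cvg_to H1 H2 _.
  by near=> n; exact: euler_fun_lipschitz.
move=> r i e r0 e0; have L0 := L_ge0 i.
have [d0 d00 Fd] := F_continuous (w r) i e0.
(* Of the allowance d0, a quarter goes to each of: the limit at time r, the
   Lipschitz drift over a time d, and the drift over one Euler step. *)
pose d := d0 / (4 * (L + 1)).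
have d_gt0 : 0 < d by rewrite divr_gt0// mulr_gt0//; lra.
have Ld : L * d <= d0 / 4.
  have -> : L * d = (d0 / 4) * (L / (L + 1)).
    by rewrite /d; field; rewrite gt_eqF//; lra.
  rewrite ler_piMr ?divr_ge0 ?(ltW d00)// ler_pdivrMr; lra.
exists d => // s t s0 st sd td; have t0 := le_trans s0 st.
have H1 : `|euler_fun n t i - euler_fun n s i - (t - s) * F (w r) i| @[n --> G]
    --> `|w t i - w s i - (t - s) * F (w r) i|.
  apply: cvg_norm; apply: cvgB; last exact: cvg_cst.
  by apply: cvgB; exact: wcvg.
have H2 : (t - s) * e + step n * (e + L) @[n --> G] --> (t - s) * e + 0 * (e + L).
  by apply: cvgD; [exact: cvg_cst|apply: cvgM => //; exact: cvg_cst].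
rewrite mul0r addr0 [(t - s) * e]mulrC in H2.
apply: ler_cvg_to H1 H2 _.
near=> n.
have wr j : `|w r j - euler_fun n r j| < d0 / 4.
  move: j; near: n; apply: filter_forall => j.
  by move/cvgrPdist_lt : (wcvg r j r0); apply; rewrite divr_gt0.
have Lh : L * step n <= d0 / 4.
  near: n; have : L * step n @[n --> G] --> L * 0.
    by apply: cvgM => //; exact: cvg_cst.
  rewrite mulr0 => /cvgr_le; apply; rewrite divr_gt0//.
rewrite [e * _]mulrC; apply: euler_fun_increment => //; first exact: ltW.
move=> l /andP[kl lm]; apply/ltW/Fd => j.
have -> : euler n l j - w r j = (euler n l j - euler_fun n r j)
   + (euler_fun n r j - w r j) by ring.
apply: le_lt_trans (ler_normD _ _) _.
have {}wr := wr j; rewrite distrC in wr.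
suff : `|euler n l j - euler_fun n r j| <= L * (d + step n).
  rewrite mulrDr => ?; lra.
apply: le_trans (euler_lipschitz _ _ _ _) _; rewrite ler_wpM2l//.
have h0 := step_gt0 n.
have kl' : (Num.truncn (s * n.+1%:R))%:R * step n <= l%:R * step n.
  by rewrite ler_pM2r// ler_nat.
have lm' : l%:R * step n <= (Num.truncn (t * n.+1%:R))%:R * step n.
  by rewrite ler_pM2r// ler_nat ltnW.
have /andP[? ?] := truncn_step n s0; have /andP[? ?] := truncn_step n t0.
have /andP[? ?] := truncn_step n r0.
move: sd td; rewrite !ltr_norml => /andP[? ?] /andP[? ?].
by rewrite ler_norml; apply/andP; split; lra.
Unshelve. all: by end_near. Qed.

End Peano.

(** * One-variable calculus *)

Section RealFunctions.
Variable R : realType.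
Implicit Types (f : R -> R) (a b l q s t : R).

Lemma within_continuousP (D : set R) f :
  {within D, continuous f} <->
  forall x, D x -> forall e, 0 < e -> exists2 d, 0 < d &
    forall y, D y -> `|y - x| < d -> `|f y - f x| < e.
Proof.
split=> [/subspace_continuousP cf x Dx e e0|cf].
  have /cvgrPdist_lt/(_ e e0) := cf x Dx.
  move=> /nbhs_ballP[d /= d0 H]; exists d => // y Dy yx.
  by rewrite distrC; apply: H => //; rewrite /ball/= distrC.
apply/subspace_continuousP => x Dx; apply/cvgrPdist_lt => e e0.
have [d d0 H] := cf x Dx e e0; apply/nbhs_ballP; exists d => // y /= xy Dy.
by rewrite distrC; apply: H => //; rewrite distrC.
Qed.

Lemma left_min_derive1_le0 f a s : a < s -> derivable f s 1 ->
  (forall t, a < t < s -> f s <= f t) -> derive1 f s <= 0.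
Proof.
move=> as_ df fs; rewrite leNgt; apply/negP => f's.
have := derivable_quotient_cvg df; move/cvgr_gt => /(_ _ f's).
move=> /nbhs_ballP[e /= e0 He].
pose k := Num.min (e / 2) ((s - a) / 2).
have k0 : 0 < k by rewrite lt_min !divr_gt0// subr_gt0.
have [ke ks] : k <= e / 2 /\ k <= (s - a) / 2 by rewrite /k !ge_min !lexx orbT.
have : 0 < (- k)^-1 * (f (- k + s) - f s).
  apply: He; last by rewrite oppr_eq0 gt_eqF.
  by rewrite /ball/= sub0r opprK gtr0_norm//; lra.
rewrite nmulr_rgt0 ?invr_lt0 ?oppr_lt0// subr_lt0 ltNge fs//.
by apply/andP; split; lra.
Qed.

(** At the first time s where f touches the level l from above, f' (s) <= 0. *)
Lemma stays_above f a b l : a <= b -> {within `[a, b], continuous f} ->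
  (forall t, a < t <= b -> derivable f t 1) -> l < f a ->
  (forall t, a < t <= b -> f t = l -> 0 < derive1 f t) ->
  forall t, a <= t <= b -> l < f t.
Proof.
move=> ab /within_continuousP cf df fa up t /andP[at_ tb].
rewrite ltNge; apply/negP => ft.
pose A := [set x | a <= x <= t /\ f x <= l].
have infA : has_inf A.
  by split; [exists t; split; rewrite ?at_ ?lexx|exists a => x [/andP[]]].
pose s := inf A.
have as_ : a <= s by apply: lb_le_inf; [exact: infA.1|move=> x [/andP[]]].
have st : s <= t.
  by apply: ge_inf; [exact: infA.2|split; rewrite ?at_ ?lexx].
have I : forall x, a <= x <= t -> `[a, b]%classic x.
  by move=> x /andP[ax xt]; rewrite /= in_itv/= ax (le_trans xt tb).
have before x : a <= x -> x < s -> l < f x.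
  move=> ax xs; rewrite ltNge; apply/negP => fx.
  suff : s <= x by rewrite leNgt xs.
  apply: ge_inf; first exact: infA.2.
  by split=> //; rewrite ax ltW// (lt_le_trans xs).
have Is : `[a, b]%classic s by apply: I; rewrite as_ st.
have fs : f s <= l.
  rewrite leNgt; apply/negP => ls.
  have [|d d0 Hd] := cf s Is (f s - l); first by rewrite subr_gt0.
  have [x [/andP[ax xt] fx] xs] := @inf_adherent _ A d d0 infA.
  have sx : s <= x by apply: ge_inf; [exact: infA.2|split; rewrite ?ax].
  have Ix : `[a, b]%classic x by apply: I; rewrite ax xt.
  have xsd : `|x - s| < d by rewrite ger0_norm ?subr_ge0// ltrBlDl.
  by have := Hd x Ix xsd; rewrite ltr_norml => /andP[? ?]; lra.
have as' : a < s.
  by rewrite lt_def as_ andbT; apply/eqP => sa; move: fs; rewrite sa leNgt fa.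
have sb := le_trans st tb.
have fsl : f s = l.
  apply/eqP; rewrite eq_le fs/= leNgt; apply/negP => sl.
  have [|d d0 Hd] := cf s Is (l - f s); first by rewrite subr_gt0.
  pose x := Num.max a (s - d / 2).
  have ax : a <= x by rewrite /x le_max lexx.
  have sdx : s - d / 2 <= x by rewrite /x le_max lexx orbT.
  have xs : x < s by rewrite /x gt_max as'; lra.
  have Ix : `[a, b]%classic x by apply: I; rewrite ax (ltW (lt_le_trans xs st)).
  have xsd : `|x - s| < d by rewrite ltr0_norm ?subr_lt0//; lra.
  have := before x ax xs.
  by have := Hd x Ix xsd; rewrite ltr_norml => /andP[? ?] ?; lra.
have := up s; rewrite as' sb => /(_ isT fsl); rewrite ltNge => /negP; apply.
apply: (left_min_derive1_le0 as'); first by apply: df; rewrite as'.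
by move=> x /andP[ax xs]; rewrite fsl ltW// before// ltW.
Qed.

(** f' >= a f^q makes f^(1-q) + (q - 1) a t nonincreasing, while f^(1-q) > 0. *)
Lemma power_growth_time f a b q : 1 < q -> 0 < a -> 0 <= b ->
  {within `[0, b], continuous f} ->
  (forall t, 0 < t <= b -> derivable f t 1) ->
  (forall t, 0 <= t <= b -> 0 < f t) ->
  (forall t, 0 < t <= b -> a * f t `^ q <= derive1 f t) ->
  b <= f 0 `^ (1 - q) / ((q - 1) * a).
Proof.
move=> q1 a0; rewrite le_eqVlt => /predU1P[<- _ _ f0 _|b0 cf df f0 f'].
  by rewrite divr_ge0 ?powR_ge0// mulr_ge0 ?subr_ge0 ?(ltW q1) ?(ltW a0).
have qa : 0 < (q - 1) * a by rewrite mulr_gt0// subr_gt0.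
pose g t := f t `^ (1 - q) + (q - 1) * a * t.
pose g' t := (1 - q) * f t `^ (1 - q - 1) * derive1 f t + (q - 1) * a.
have dg x : x \in `]0, b[ -> is_derive x 1 g (g' x).
  rewrite in_itv/= => /andP[x0 xb].
  have dfx : is_derive x 1 f (derive1 f x).
    by rewrite derive1E; apply/derivableP/df; rewrite x0 ltW.
  have fx : 0 < f x by apply: f0; rewrite (ltW x0) (ltW xb).
  have -> : g = (fun y : R => y `^ (1 - q)) \o f + ((q - 1) * a) \*: id.
    by apply/funext => t; rewrite /g !fctE.
  apply: is_deriveD.
    by apply: is_derive1_comp; exact: is_derive1_powR.
  by apply: is_derive_eq; rewrite [_ *: _]mulr1.
have cg : {within `[0, b], continuous g}.
  apply/subspace_continuousP => x xb; apply: cvgD.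
    have cp : {for f x, continuous (fun y : R => y `^ (1 - q))}.
      apply: differentiable_continuous; apply/derivable1_diffP.
      by apply: derivable_powR; rewrite in_itv/= andbT f0//; move: xb; rewrite /= in_itv.
    by apply: (continuous_cvg _ cp); move/subspace_continuousP : cf; apply.
  by apply: cvgM; [exact: cvg_cst|exact: cvg_within].
have [c cb] := MVT b0 dg cg; rewrite subr0 => gb.
have g'c : g' c <= 0.
  move: cb; rewrite in_itv/= => /andP[c0 cb'].
  have fc : 0 < f c by apply: f0; rewrite (ltW c0) (ltW cb').
  have -> : g' c = (1 - q) * f c `^ (- q) * (derive1 f c - a * f c `^ q).
    rewrite /g' [in RHS]mulrBr; congr (_ + _); first by congr (_ * _ `^ _ * _); ring.
    have := powR_gt0 q fc; rewrite powRN => fq; field; exact: lt0r_neq0.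
  apply: mulr_le0_ge0; last by rewrite subr_ge0 f' ?c0 ?(ltW cb').
  by rewrite mulr_le0_ge0 ?powR_ge0// subr_le0 (ltW q1).
have := mulr_le0_ge0 g'c (ltW b0); rewrite -gb subr_le0 /g mulr0 addr0 => gg.
rewrite ler_pdivlMr// mulrC; apply: le_trans gg.
by rewrite lerDr powR_ge0.
Qed.

Lemma increment_is_derive f t c :
  (forall e, 0 < e -> exists2 d, 0 < d & forall h, `|h| < d ->
     `|f (h + t) - f t - h * c| <= e * `|h|) ->
  is_derive t 1 f c.
Proof.
move=> H; have qc : h^-1 * (f (h + t) - f t) @[h --> 0^'] --> c.
  apply/cvgrPdist_le => e e0; have [d d0 Hd] := H e e0.
  apply/nbhs_ballP; exists d => // h /=; rewrite /ball/= sub0r normrN => hd h0.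
  rewrite distrC -(ler_pM2r (_ : 0 < `|h|)) ?normr_gt0// -normrM.
  by rewrite mulrBl mulrAC mulVf// mul1r [c * h]mulrC; exact: Hd.
have df := quotient_cvg_derivable qc.
split=> //; rewrite -derive1E; apply: cvg_unique qc => //.
exact: derivable_quotient_cvg.
Qed.

(** A one-sided derivative at an end point is the limit of the derivative, by
    the mean value theorem; stated for increments so that it can be joined with
    [peano] on the other side. *)
Lemma left_increment f (f' : R -> R) a b c : a < b ->
  (forall t, a < t < b -> is_derive t 1 f (f' t)) ->
  f t @[t --> b^'-] --> f b -> f' t @[t --> b^'-] --> c ->
  forall e, 0 < e -> exists2 d, 0 < d & forall s, a < s < b -> b - s < d ->
    `|f b - f s - (b - s) * c| <= e * (b - s).
Proof.
move=> ab df fb f'c e e0; move/cvgrPdist_le : f'c => /(_ e e0).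
move=> /nbhs_ballP[d /= d0 Hd]; exists d => // s /andP[as_ sb] bsd.
have dfs : {in `]s, b[, forall x, derivable f x 1}.
  move=> x; rewrite in_itv/= => /andP[sx xb].
  by have [] := df x; rewrite ?xb ?(lt_trans as_).
have cf : {within `[s, b], continuous f}.
  apply: derivable_oo_LRcontinuous_within; split => //.
  apply: cvg_at_right_filter; apply: differentiable_continuous.
  by apply/derivable1_diffP; have [] := df s; rewrite ?as_ ?sb.
have dfsb x : x \in `]s, b[ -> is_derive x 1 f (f' x).
  by rewrite in_itv/= => /andP[sx xb]; apply: df; rewrite xb (lt_trans as_).
have [x] := MVT sb dfsb cf; rewrite in_itv/= => /andP[sx xb] ->.
have bs : 0 < b - s by rewrite subr_gt0.
rewrite [(b - s) * c]mulrC -mulrBl normrM (gtr0_norm bs) ler_pM2r// distrC.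
by apply: Hd => //; rewrite /ball/= gtr0_norm ?subr_gt0//; lra.
Qed.

End RealFunctions.

(** * The boundary condition as a nonlinear mean *)

Lemma finite_bound (R : realType) (V : finType) (A : Type) (D : set A) (P : pred V) (f : V -> A -> R) :
  (forall x, P x -> exists K, forall a, D a -> f x a <= K) ->
  exists2 K, 0 <= K & forall x a, P x -> D a -> f x a <= K.
Proof.
move=> H; have /choice[K fK] x : exists K, P x -> forall a, D a -> f x a <= K.
  have [Px|Px] := boolP (P x); last by exists 0.
  by have [K] := H x Px; exists K.
exists (\sum_x `|K x|); first by rewrite sumr_ge0.
move=> x a Px Da; apply: le_trans (fK x Px a Da) _.
by rewrite (bigD1 x)//= (le_trans (ler_norm _))// lerDl sumr_ge0.
Qed.

Section Network.
Variables (R : realType) (V : finType) (G : network R V) (S : {set V}).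
Variables (p q lambda : R) (mu sigma u0 : V -> R).
Hypothesis mu_ge0 : forall z, z \in bdry G S -> 0 <= mu z.
Hypothesis sigma_ge0 : forall z, z \in bdry G S -> 0 <= sigma z.
Hypothesis musigma_gt0 : forall z, z \in bdry G S -> 0 < mu z + sigma z.
Hypothesis lambda_gt0 : 0 < lambda.
Hypothesis p_gt1 : 1 < p.
Hypothesis pm1_lt_q : p - 1 < q.
Hypothesis q_gt1 : 1 < q.
Implicit Types (x y z : V) (w : V -> R) (t : R) (T : \bar R).

Lemma mem_sbar x : (x \in sbar G S) = (x \in S) || (x \in bdry G S).
Proof. by rewrite /sbar finset.in_setU. Qed.

Lemma bdry_notin z : z \in bdry G S -> z \in S = false.
Proof. by rewrite /bdry inE => /andP[/negbTE]. Qed.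

Lemma sbar_weight_ge0 x y : 0 <= sbar_weight G S x y.
Proof. by rewrite /sbar_weight; case: ifP => // _; exact: weight_ge0. Qed.

Lemma p_laplacianE w x :
  p_laplacian G S p w x =
  \sum_(y in sbar G S) ppow p (w y - w x) * sbar_weight G S x y.
Proof. by apply: eq_bigr => y _; rewrite /ppow distrC. Qed.

Lemma reactionE (s : R) : lambda * `|s| `^ (q - 1) * s = lambda * ppow (q + 1) s.
Proof. by rewrite /ppow -mulrA; congr (_ * (_ `^ _ * _)); ring. Qed.

(** The boundary condition at z reads [psum p (bweight z) (bval w) (w z) = 0]:
    the term with sigma is one more entry, of value 0.  It is stored at the
    index z itself, which is free because z is not in S. *)
Definition bweight z y : R :=
  if y \in S then mu z * sbar_weight G S z y else if y == z then sigma z else 0.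

Definition bval w y : R := if y \in S then w y else 0.

(** The closed-network function determined by its interior values. *)
Definition extend w y : R :=
  if y \in S then w y else pmean p (bweight y) (bval w).

Lemma bweight_nontrivial z : z \in bdry G S -> nontrivial_weight (bweight z).
Proof.
move=> zb; split.
  move=> y; rewrite /bweight; case: ifP => _.
    by rewrite mulr_ge0 ?mu_ge0// sbar_weight_ge0.
  by case: ifP => // _; exact: sigma_ge0.
have [s0|s0] := ltP 0 (sigma z).
  by exists z; rewrite /bweight bdry_notin// eqxx.
have m0 : 0 < mu z.
  by apply: lt_le_trans (musigma_gt0 zb) _; rewrite gerDl.
move: zb; rewrite inE => /andP[zS /existsP[y /andP[yS yz]]]; exists y.
by rewrite /bweight yS mulr_gt0// /sbar_weight yS orbT weight_sym weight_gt0.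
Qed.

Lemma boundary_psum w z : z \in bdry G S ->
  mu z * p_normal_derivative G S p w z + sigma z * `|w z| `^ (p - 2) * w z
  = psum p (bweight z) (bval w) (w z).
Proof.
move=> zb; have zS := bdry_notin zb.
rewrite /psum (bigID (mem S))/=; congr (_ + _).
  rewrite /p_normal_derivative mulr_sumr; apply: eq_bigr => y yS.
  by rewrite /bweight /bval yS /ppow -[RHS]mulrA [_ * (_ * (w z - _))]mulrC.
rewrite (bigD1 z) ?zS//= big1 ?addr0; last first.
  move=> y /andP[yS yz]; rewrite /bweight (negbTE yS) (negbTE yz).
  by rewrite mul0r.
by rewrite /bweight /bval zS eqxx subr0 -mulrA.
Qed.

Lemma boundary_extend w z : z \in bdry G S ->
  mu z * p_normal_derivative G S p w z + sigma z * `|w z| `^ (p - 2) * w z = 0 ->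
  w z = extend w z.
Proof.
move=> zb; rewrite boundary_psum// => w0; rewrite /extend bdry_notin//.
by rewrite (pmeanP p_gt1 (bweight_nontrivial zb) w0).
Qed.

Lemma bval_extend w : bval (extend w) = bval w.
Proof. by apply/funext => y; rewrite /bval /extend; case: (y \in S). Qed.

Lemma extend_boundary w z : z \in bdry G S ->
  mu z * p_normal_derivative G S p (extend w) z
  + sigma z * `|extend w z| `^ (p - 2) * extend w z = 0.
Proof.
move=> zb; rewrite boundary_psum// bval_extend /extend bdry_notin//.
by rewrite psum_pmean//; exact: bweight_nontrivial.
Qed.

Lemma extend_ge w (c : R) z : z \in bdry G S -> c <= 0 ->
  (forall y, y \in S -> c <= w y) -> c <= extend w z.
Proof.
move=> zb c0 cw; rewrite /extend bdry_notin//; apply: pmean_ge => //.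
  exact: bweight_nontrivial.
by move=> y; rewrite /bval; case: ifP => // /cw.
Qed.

(** * Nonnegativity and the scalar growth inequality *)

Section Solution.
Variables (T : \bar R) (u : V -> R -> R).
Hypothesis sol : is_solution G S p q lambda mu sigma u0 T u.
Hypothesis u0_ge0 : forall x, x \in sbar G S -> 0 <= u0 x.

Lemma sol_extend z t : z \in bdry G S -> 0 <= t -> (t%:E < T)%E ->
  u z t = extend (u ^~ t) z.
Proof.
by move=> zb t0 tT; apply: (@boundary_extend (u ^~ t)) => //; exact: (sol_boundary sol).
Qed.

Lemma sol_continuous_itv x (a b : R) : x \in sbar G S -> 0 <= a -> (b%:E < T)%E ->
  {within `[a, b], continuous (u x)}.
Proof.
move=> xs a0 bT; apply: continuous_subspaceW (sol_continuous sol xs) => t /=.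
rewrite in_itv/= => /andP[at_ tb]; split; first exact: le_trans at_.
by apply: le_lt_trans bT; rewrite lee_fin.
Qed.

Lemma sol_equation_ppow x t : x \in S -> 0 < t -> (t%:E < T)%E ->
  derive1 (u x) t = p_laplacian G S p (u ^~ t) x + lambda * ppow (q + 1) (u x t).
Proof. by move=> xS t0 tT; rewrite (sol_equation sol)// reactionE. Qed.

(** Minimise exp (- k t) u over S and [0, s].  At a negative minimum the time
    derivative gives u' <= k u, whereas the equation gives
    u' >= lambda K^(q-1) u > k u, with K a bound of |u|. *)
Lemma solution_ge0 x t : x \in sbar G S -> 0 <= t -> (t%:E < T)%E -> 0 <= u x t.
Proof.
suff core y s : y \in S -> 0 <= s -> (s%:E < T)%E -> 0 <= u y s.
  rewrite mem_sbar => /orP[xS|xb] t0 tT; first exact: core.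
  by rewrite sol_extend//; apply: extend_ge => // y yS; exact: core.
clear x t; move=> yS s0 sT; rewrite leNgt; apply/negP => uy.
have Ssb z : z \in S -> z \in sbar G S by rewrite mem_sbar => ->.
have cu z : z \in S -> {within `[0, s], continuous (u z)}.
  by move=> zS; apply: sol_continuous_itv => //; exact: Ssb.
have [K K0 uK] : exists2 K, 0 <= K & forall z t, z \in S -> `[0, s]%classic t ->
    `|u z t| <= K.
  apply: (finite_bound (f := fun z t => `|u z t|)) => z zS.
  have cn : {within `[0, s], continuous (fun t => `|u z t|)}.
    by move=> r; apply: cvg_norm; exact: cu.
  have [c _ cK] := EVT_max s0 cn; exists `|u z c| => r rs.
  by apply: cK; move: rs; rewrite /= in_itv.
(* Any k above the Lipschitz constant lambda K^(q-1) of the reaction at 0 will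
   do. *)
pose k := lambda * K `^ (q - 1) + 1.
pose g z t := expR (- k * t) * u z t.
have cg z : z \in S -> {within `[0, s], continuous (g z)}.
  move=> zS r; apply: cvgM; last exact: cu.
  apply: (@continuous_subspaceT _ _ _ (fun t => expR (- k * t))) => {}r.
  apply: (@continuous_cvg _ _ _ _ _ (fun t : R => - k * t) expR).
    exact: continuous_expR.
  by apply: cvgM; [exact: cvg_cst|exact: cvg_id].
have /choice[m gm] z : exists m, z \in S -> m \in `[0, s] /\
    forall r, r \in `[0, s] -> g z m <= g z r.
  have [zS|] := boolP (z \in S); last by exists 0.
  by have [m m1 m2] := EVT_min s0 (cg z zS); exists m.
have [x xS xmin] : exists2 x, x \in S & forall z, z \in S -> g x (m x) <= g z (m z).
  by case: (@arg_minP _ _ _ y (mem S) (fun z => g z (m z)) yS) => x; exists x.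
have [mx _] := gm x xS; set r := m x in mx xmin.
have gmin z t' : z \in S -> t' \in `[0, s] -> g x r <= g z t'.
  by move=> zS t's; apply: le_trans (xmin z zS) _; exact: (gm z zS).2.
have ysI : s \in `[0, s] by rewrite in_itv/= s0 lexx.
have gx : g x r < 0.
  by apply: le_lt_trans (gmin y s yS ysI) _; rewrite pmulr_rlt0// expR_gt0.
have ux : u x r < 0 by move: gx; rewrite pmulr_rlt0// expR_gt0.
have r0 : 0 < r.
  move: mx; rewrite in_itv/= => /andP[r0 _]; rewrite lt_def r0 andbT.
  apply/eqP => rE; move: ux; rewrite rE (sol_initial sol) ?Ssb//.
  by rewrite ltNge u0_ge0// Ssb.
have rs : r <= s by move: mx; rewrite in_itv/= => /andP[].
have rT : (r%:E < T)%E by apply: le_lt_trans sT; rewrite lee_fin.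
have minS z : z \in S -> u x r <= u z r.
  move=> zS; have := gmin z r zS mx.
  by rewrite /g ler_pM2l// expR_gt0.
(* The boundary values are means of interior values and of 0, so the minimum
   over S is a minimum over the closed network. *)
have minsb z : z \in sbar G S -> u x r <= u z r.
  rewrite mem_sbar => /orP[/minS//|zb]; rewrite (sol_extend zb (ltW r0) rT).
  by apply: extend_ge => //; exact: ltW.
have du : is_derive r 1 (u x) (derive1 (u x) r).
  by rewrite derive1E; apply/derivableP/(sol_derivable sol) => //; exact: Ssb.
have dg : is_derive r 1 (g x)
    (expR (- k * r) * (derive1 (u x) r - k * u x r)).
  have de : is_derive r 1 (expR \o (- k \*: id)) (expR (- k * r) * - k).
    by apply: is_derive1_comp; apply: is_derive_eq; rewrite [_ *: 1]mulr1.
  have -> : g x = (expR \o (- k \*: id)) * u x by apply/funext.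
  by apply: is_derive_eq; rewrite /GRing.scale/=; ring.
have [dg1 dg2] := dg; have := @left_min_derive1_le0 _ (g x) 0 r r0 dg1.
rewrite derive1E dg2 pmulr_rle0 ?expR_gt0// subr_le0.
have -> : (forall t', 0 < t' < r -> g x r <= g x t') = True.
  apply/propext; split=> // _ t' /andP[t'0 t'r]; apply: gmin => //.
  by rewrite in_itv/= (ltW t'0) (le_trans (ltW t'r)).
move=> /(_ I); apply/negP; rewrite -ltNge.
apply: lt_le_trans (_ : lambda * ppow (q + 1) (u x r) <= _); last first.
  rewrite sol_equation_ppow// lerDr p_laplacianE sumr_ge0// => z zs.
  by rewrite mulr_ge0 ?sbar_weight_ge0// ppow_ge0// subr_ge0 minsb.
have -> : lambda * ppow (q + 1) (u x r) = lambda * `|u x r| `^ (q - 1) * u x r.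
  by rewrite reactionE.
rewrite ltr_nM2r// /k; apply: le_lt_trans (_ : lambda * K `^ (q - 1) < _); last first.
  by rewrite ltrDl.
rewrite ler_pM2l//; apply: ge0_ler_powR; rewrite ?nnegrE ?subr_ge0 ?(ltW q_gt1)//.
by apply: uK => //; rewrite /= in_itv/= (ltW r0).
Qed.

(** For u >= 0 each neighbour pulls x down by at most ppow p (u x), as if it had
    the value 0. *)
Lemma solution_growth x t : x \in S -> 0 < t -> (t%:E < T)%E ->
  lambda * u x t `^ q - max_over S (degree G S) * u x t `^ (p - 1)
    <= derive1 (u x) t.
Proof.
move=> xS t0 tT; have xs : x \in sbar G S by rewrite mem_sbar xS.
have ux := solution_ge0 xs (ltW t0) tT.
rewrite sol_equation_ppow// addrC.
rewrite ppow_ge0E ?ltrDr ?(lt_trans ltr01)// addrK lerD2r.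
rewrite -ppow_ge0E// p_laplacianE lerNl.
apply: le_trans (_ : degree G S x * ppow p (u x t) <= _); last first.
  by apply: ler_wpM2r; [exact: ppow_ge0|exact: le_bigmax_cond].
rewrite /degree mulr_suml -sumrN; apply: ler_sum => y ys.
rewrite -mulNr mulrC; apply: ler_wpM2l; first exact: sbar_weight_ge0.
rewrite -ppowN; apply: ppow_le => //.
by rewrite opprB gerBl solution_ge0// ltW.
Qed.

(** * Above the threshold *)

Let D := max_over S (degree G S).
Let threshold := (D / lambda) `^ (q - p + 1)^-1.

(** With r = q - p + 1, the difference equals v^q (lambda - D v^(-r)), and the
    bracket is nondecreasing in v and positive above the threshold. *)
Lemma reaction_dominates (l : R) : threshold < l ->
  exists2 a, 0 < a & forall v, l <= v -> a * v `^ q <= lambda * v `^ q - D * v `^ (p - 1).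
Proof.
move=> cl; pose r := q - p + 1; have r0 : 0 < r by rewrite /r; move: pm1_lt_q; lra.
have D0 : 0 <= D by exact: bigmax_ge_id.
have l0 : 0 < l by apply: le_lt_trans cl; exact: powR_ge0.
have lr : D < lambda * l `^ r.
  rewrite mulrC -ltr_pdivrMr//.
  have -> : D / lambda = threshold `^ r.
    by rewrite -powRrM mulVf ?gt_eqF// powRr1// divr_ge0// ltW.
  by apply: gt0_ltr_powR; rewrite ?nnegrE ?powR_ge0// ltW.
exists (lambda - D * l `^ (- r)).
  by rewrite subr_gt0 powRN ltr_pdivrMr// powR_gt0.
move=> v lv; have v0 := lt_le_trans l0 lv.
rewrite mulrBl lerD2l lerN2.
have -> : p - 1 = - r + q by rewrite /r; ring.
rewrite powRD; last by rewrite (gt_eqF v0) implybT.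
rewrite mulrA ler_wpM2r ?powR_ge0// ler_wpM2l//.
rewrite !powRN lef_pV2 ?posrE ?powR_gt0//.
by apply: ge0_ler_powR; rewrite ?nnegrE ?(ltW l0) ?(ltW v0) ?(ltW r0).
Qed.

Lemma solution_stays_above x (l t s : R) : x \in S -> threshold < l ->
  0 <= t -> l < u x t -> t <= s -> (s%:E < T)%E -> l < u x s.
Proof.
move=> xS cl t0 lt ts sT; have xs : x \in sbar G S by rewrite mem_sbar xS.
have before r : r <= s -> (r%:E < T)%E.
  by move=> rs; apply: le_lt_trans sT; rewrite lee_fin.
apply: (@stays_above _ (u x) t s l ts) => //; last by rewrite ts lexx.
- exact: sol_continuous_itv.
- move=> r /andP[tr rs]; apply: (sol_derivable sol) => //; last exact: before.
  exact: le_lt_trans tr.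
move=> r /andP[tr rs] url; have r0 := le_lt_trans t0 tr.
have [a a0 /(_ l (lexx l)) al] := reaction_dominates cl.
have := solution_growth xS r0 (before r rs); rewrite url; apply: lt_le_trans.
apply: lt_le_trans al; rewrite mulr_gt0// powR_gt0//.
by apply: le_lt_trans cl; exact: powR_ge0.
Qed.

Lemma solution_lifetime x : x \in S -> threshold < u0 x ->
  exists B : R, forall t, 0 <= t -> (t%:E < T)%E -> t <= B.
Proof.
move=> xS cu; have xs : x \in sbar G S by rewrite mem_sbar xS.
pose l := (threshold + u0 x) / 2.
have cl : threshold < l by rewrite /l; lra.
have lu : l < u0 x by rewrite /l; lra.
have l0 : 0 < l by apply: le_lt_trans cl; exact: powR_ge0.
have [a a0 al] := reaction_dominates cl.
exists (u x 0 `^ (1 - q) / ((q - 1) * a)) => t t0 tT.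
have before r : r <= t -> (r%:E < T)%E.
  by move=> rt; apply: le_lt_trans tT; rewrite lee_fin.
have ul r : 0 <= r -> r <= t -> l < u x r.
  move=> r0 rt; apply: (solution_stays_above xS cl (lexx 0)) => //.
    by rewrite (sol_initial sol).
  exact: before.
apply: power_growth_time => //.
- exact: sol_continuous_itv.
- by move=> r /andP[r0 rt]; apply: (sol_derivable sol) => //; exact: before.
- by move=> r /andP[r0 rt]; apply: lt_trans (ul r r0 rt).
move=> r /andP[r0 rt]; apply: le_trans (solution_growth xS r0 (before r rt)).
by apply: al; rewrite ltW// ul// ltW.
Qed.

(** Unboundedness is enough for divergence: having once exceeded a level above
    the threshold, u x never returns to it. *)
Lemma unbounded_blows_up x (T0 : R) : T = T0%:E -> x \in S ->
  (forall K, exists t, [/\ 0 <= t, t < T0 & K < u x t]) ->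
  `|u x t| @[t --> T0^'-] --> +oo.
Proof.
move=> TE xS unb; apply/cvgryPge => A.
have [t [t0 tT ut]] := unb (Num.max A (threshold + 1)).
near=> s; have ts : t < s by near: s; exact: nbhs_left_gt.
apply: le_trans (ler_norm _); apply: (@le_trans _ _ (Num.max A (threshold + 1))).
  by rewrite le_max lexx.
apply/ltW/(solution_stays_above xS _ t0 ut (ltW ts)).
  by rewrite lt_max ltrDl ltr01 orbT.
by rewrite TE lte_fin; near: s; exact: nbhs_left_lt.
Unshelve. all: by end_near. Qed.

(** * The interior vector field *)

Lemma extend_eq w w' : (forall y, y \in S -> w y = w' y) -> extend w =1 extend w'.
Proof.
move=> ww' y; rewrite /extend; case: ifP => [/ww'//|_]; congr (pmean _ _ _).
by apply/funext => z; rewrite /bval; case: ifP => // /ww'.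
Qed.

Lemma extend_norm w (M : R) y : y \in sbar G S -> (forall z, `|w z| <= M) ->
  `|extend w y| <= M.
Proof.
move=> ys wM; rewrite /extend; case: ifP => // yS; apply: pmean_norm => //.
  by apply: bweight_nontrivial; move: ys; rewrite mem_sbar yS.
move=> z; rewrite /bval; case: ifP => // _; rewrite normr0.
exact: le_trans (wM z).
Qed.

Lemma extend_cvg (A : Type) (H : set_system A) {FH : Filter H}
    (w_ : A -> V -> R) w y : y \in sbar G S ->
  (forall z, w_ n z @[n --> H] --> w z) ->
  extend (w_ n) y @[n --> H] --> extend w y.
Proof.
move=> ys ww; rewrite /extend; case: ifP => [_//|yS].
have wb : nontrivial_weight (bweight y).
  by apply: bweight_nontrivial; move: ys; rewrite mem_sbar yS.
apply/cvgrPdist_le => e e0; near=> n.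
apply: pmean_dist => // z; rewrite /bval; case: ifP => _; last first.
  by rewrite subrr normr0 ltW.
move: z; near: n; apply: filter_forall => z.
by move/cvgrPdist_le : (ww z); apply.
Unshelve. all: by end_near. Qed.

(** With the boundary values eliminated, the problem is the ordinary
    differential equation w' = field w on S. *)
Definition field w x : R :=
  p_laplacian G S p (extend w) x + lambda * ppow (q + 1) (w x).

Lemma field_eq w w' x : x \in S -> (forall y, y \in S -> w y = w' y) ->
  field w x = field w' x.
Proof.
move=> xS ww'; rewrite /field ww'//; congr (_ + _).
by congr (p_laplacian _ _ _ _ _); apply/funext; exact: extend_eq.
Qed.

Lemma q1_gt1 : 1 < q + 1.
Proof. by rewrite ltrDr (lt_trans ltr01). Qed.

Lemma field_cvg (A : Type) (H : set_system A) {FH : Filter H}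
    (w_ : A -> V -> R) w x : x \in S ->
  (forall z, w_ n z @[n --> H] --> w z) -> field (w_ n) x @[n --> H] --> field w x.
Proof.
move=> xS ww; rewrite /field; apply: cvgD; last first.
  by apply: cvgM; [exact: cvg_cst|apply: ppow_cvg => //; exact: q1_gt1].
rewrite p_laplacianE.
rewrite [X in X @ _](_ : _ = fun n => \sum_(y in sbar G S)
  ppow p (extend (w_ n) y - extend (w_ n) x) * sbar_weight G S x y); last first.
  by apply/funext => n; rewrite p_laplacianE.
apply: cvg_sumr => y ys; apply: cvgM; last exact: cvg_cst.
apply: ppow_cvg => //; apply: cvgB; apply: extend_cvg => //.
by rewrite mem_sbar xS.
Qed.

(** Truncation at height M: it makes [field] bounded without changing it on the
    cube [- M, M]^V. *)
Definition clip (M : R) w x : R := Num.max (- M) (Num.min M (w x)).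

Lemma clip_id (M : R) w x : `|w x| <= M -> clip M w x = w x.
Proof.
by rewrite ler_norml => /andP[Mw wM]; rewrite /clip min_r// max_r.
Qed.

Lemma clip_norm (M : R) w x : 0 <= M -> `|clip M w x| <= M.
Proof.
move=> M0; rewrite /clip ler_norml le_max lexx/= ge_max ge_min lexx/= andbT.
by rewrite (le_trans _ M0)// oppr_le0.
Qed.

Lemma clip_cvg (M : R) (A : Type) (H : set_system A) {FH : Filter H}
    (w_ : A -> V -> R) w z :
  w_ n z @[n --> H] --> w z -> clip M (w_ n) z @[n --> H] --> clip M w z.
Proof.
move=> ww; rewrite /clip maxr_absE minr_absE.
rewrite [X in X @ _](_ : _ = fun n =>
  (- M + (M + w_ n z - `|M - w_ n z|) / 2
   + `|- M - (M + w_ n z - `|M - w_ n z|) / 2|) / 2); last first.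
  by apply/funext => n; rewrite maxr_absE minr_absE.
have mcvg : (M + w_ n z - `|M - w_ n z|) / 2 @[n --> H]
    --> (M + w z - `|M - w z|) / 2.
  apply: cvgM; last exact: cvg_cst.
  apply: cvgB; first by apply: cvgD; [exact: cvg_cst|].
  by apply: cvg_norm; apply: cvgB; [exact: cvg_cst|].
apply: cvgM; last exact: cvg_cst.
apply: cvgD; first by apply: cvgD; [exact: cvg_cst|].
by apply: cvg_norm; apply: cvgB; [exact: cvg_cst|].
Qed.

Definition truncated (M : R) w x : R := if x \in S then field (clip M w) x else 0.

Lemma truncated_bounded (M : R) : 0 <= M ->
  exists2 L, 0 <= L & forall w x, `|truncated M w x| <= L.
Proof.
move=> M0; have [|L L0 HL] := @finite_bound R V _ setT xpredT
    (fun x w => `|truncated M w x|); last first.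
  by exists L => // w x; exact: HL.
move=> x _; exists (\sum_(y in sbar G S) ppow p (M + M) * sbar_weight G S x y
  + lambda * ppow (q + 1) M) => w _.
have clipM z : `|clip M w z| <= M by exact: clip_norm.
have rhs0 : 0 <= \sum_(y in sbar G S) ppow p (M + M) * sbar_weight G S x y.
  rewrite sumr_ge0// => y _.
  by rewrite mulr_ge0 ?sbar_weight_ge0// ppow_ge0// addr_ge0.
rewrite /truncated; case: ifP => xS; last first.
  by rewrite normr0 addr_ge0// mulr_ge0 ?ppow_ge0// ltW.
have xs : x \in sbar G S by rewrite mem_sbar xS.
rewrite /field p_laplacianE; apply: le_trans (ler_normD _ _) _; apply: lerD.
  apply: le_trans (ler_norm_sum _ _ _) _; apply: ler_sum => y ys.
  rewrite normrM (ger0_norm (sbar_weight_ge0 _ _)).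
  apply: ler_wpM2r; first exact: sbar_weight_ge0.
  apply: norm_ppow_le => //; apply: le_trans (ler_normB _ _) _.
  by apply: lerD; exact: extend_norm.
rewrite normrM gtr0_norm// ler_pM2l//.
by apply: norm_ppow_le; [exact: q1_gt1|exact: clipM].
Qed.

Lemma truncated_continuous (M : R) : pointwise_continuous (truncated M).
Proof.
apply: seq_pointwise_continuous => w_ w ww x; rewrite /truncated.
case: ifP => xS; last exact: cvg_cst.
by apply: field_cvg => // z; exact: clip_cvg.
Qed.

Lemma solution_field x t : x \in S -> 0 < t -> (t%:E < T)%E ->
  derive1 (u x) t = field (u ^~ t) x.
Proof.
move=> xS t0 tT; rewrite sol_equation_ppow// /field; congr (_ + _).
have ext y : y \in sbar G S -> u y t = extend (u ^~ t) y.
  rewrite mem_sbar => /orP[yS|yb]; first by rewrite /extend yS.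
  by rewrite sol_extend// ltW.
rewrite !p_laplacianE; apply: eq_bigr => y ys; rewrite ext// (ext x)//.
by rewrite mem_sbar xS.
Qed.

(** * Continuation and conclusion *)

(** For 0 <= u <= K the growth inequality bounds u' below by - C, so that
    u + C t is nondecreasing and bounded. *)
Lemma bounded_solution_left_limit (T0 K : R) x : T = T0%:E -> x \in S ->
  (forall t, 0 <= t -> t < T0 -> u x t <= K) ->
  exists2 l, 0 <= l <= K & u x t @[t --> T0^'-] --> l.
Proof.
move=> TE xS uK; have xs : x \in sbar G S by rewrite mem_sbar xS.
have T0_gt0 : 0 < T0 by rewrite -lte_fin -TE; exact: (sol_time_gt0 sol).
have before t : t < T0 -> (t%:E < T)%E by rewrite TE lte_fin.
have ux t : 0 <= t -> t < T0 -> 0 <= u x t.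
  by move=> t0 tT; apply: solution_ge0 => //; exact: before.
have K0 : 0 <= K by apply: le_trans (uK 0 _ _); rewrite ?ux.
have D0 : 0 <= D by exact: bigmax_ge_id.
pose C := D * K `^ (p - 1); have C0 : 0 <= C by rewrite mulr_ge0 ?powR_ge0.
pose g t := u x t + C * t.
have gmono s t : 0 < s -> s <= t -> t < T0 -> g s <= g t.
  move=> s0; rewrite le_eqVlt => /predU1P[->//|st] tT.
  have du r : r \in `]s, t[ -> is_derive r 1 (u x) (derive1 (u x) r).
    rewrite in_itv/= => /andP[sr rt]; rewrite derive1E; apply/derivableP.
    by apply: (sol_derivable sol) => //; [exact: lt_trans sr|exact/before/(lt_trans rt)].
  have cu : {within `[s, t], continuous (u x)}.
    by apply: sol_continuous_itv => //; [exact: ltW|exact: before].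
  have [r] := MVT st du cu; rewrite in_itv/= => /andP[sr rt] ust.
  have r0 := lt_trans s0 sr; have rT := lt_trans rt tT.
  suff Cr : - C <= derive1 (u x) r.
    have : - C * (t - s) <= u x t - u x s.
      by rewrite ust ler_wpM2r// subr_ge0 ltW.
    by rewrite /g; lra.
  apply: le_trans (solution_growth xS r0 (before r rT)).
  rewrite -[leLHS]add0r; apply: lerD; first by rewrite mulr_ge0 ?powR_ge0// ltW.
  rewrite lerN2 ler_wpM2l//; apply: ge0_ler_powR; rewrite ?nnegrE ?subr_ge0//.
  - exact: ltW.
  - by apply: ux => //; exact: ltW.
  - by apply: uK => //; exact: ltW.
have near0 : \forall s \near T0^'-, 0 < s by exact: nbhs_left_gt.
have gc : cvg (g t @[t --> T0^'-]).
  apply: nondecreasing_at_left_is_cvgr.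
    near=> s; move=> a b; rewrite !in_itv/= => /andP[sa aT] /andP[sb bT] ab.
    by apply: gmono => //; apply: lt_trans sa; near: s.
  near=> s; exists (K + C * T0) => y [t]; rewrite /= in_itv/= => /andP[st tT] <-.
  have t0 : 0 < t by apply: lt_trans st; near: s.
  apply: lerD; first by apply: uK => //; exact: ltW.
  by rewrite ler_wpM2l// ltW.
have uc : u x t @[t --> T0^'-] --> lim (g t @[t --> T0^'-]) - C * T0.
  rewrite [X in X @ _](_ : _ = fun t => g t - C * t); last first.
    by apply/funext => t; rewrite /g addrK.
  apply: cvgB => //; apply: cvgM; first exact: cvg_cst.
  by apply: cvg_at_left_filter; exact: cvg_id.
exists (lim (g t @[t --> T0^'-]) - C * T0) => //.
apply/andP; split.
  apply: (cvgr_to_ge uc); near=> t; apply: ux; last by near: t; exact: nbhs_left_lt.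
  by apply/ltW; near: t.
apply: (cvgr_to_le uc); near=> t; apply: uK; last by near: t; exact: nbhs_left_lt.
by apply/ltW; near: t.
Unshelve. all: by end_near. Qed.

(** Restart from the left limits at T0 with a Peano solution w of the field
    truncated at M, one unit above the bound of u.  With L a bound of the
    truncated field, w moves by at most 1 during the time 1/(L+1), so the
    truncation is not felt.  The glued interior function W is differentiable at
    T0 because both one-sided derivatives equal the field there, and the
    boundary values are then differentiable as means along W. *)
Lemma bounded_solution_extends (T0 K : R) : T = T0%:E ->
  (forall x t, x \in S -> 0 <= t -> t < T0 -> u x t <= K) ->
  exists (T' : \bar R) (v : V -> R -> R),
    [/\ (T < T')%E, is_solution G S p q lambda mu sigma u0 T' v &
        forall x, x \in sbar G S -> forall t, 0 <= t -> t < T0 -> v x t = u x t].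
Proof.
move=> TE uK.
have T0_gt0 : 0 < T0 by rewrite -lte_fin -TE; exact: (sol_time_gt0 sol).
have before t : t < T0 -> (t%:E < T)%E by rewrite TE lte_fin.
have Ssb z : z \in S -> z \in sbar G S by rewrite mem_sbar => ->.
have /choice[l lP] x : exists l, x \in S ->
    0 <= l <= Num.max K 0 /\ u x t @[t --> T0^'-] --> l.
  have [xS|] := boolP (x \in S); last by exists 0.
  have [l l0K ul] := bounded_solution_left_limit TE xS (uK x ^~ xS).
  by exists l => _; split => //; rewrite le_max; case/andP: l0K => -> ->.
pose M := Num.max K 0 + 1.
have K0 : 0 <= Num.max K 0 by rewrite le_max lexx orbT.
have M0 : 0 <= M by rewrite addr_ge0.
have [L L0 FL] := truncated_bounded M0.
pose a x := if x \in S then l x else 0.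
have [w [w0 wL wF]] := peano a FL (@truncated_continuous M).
pose T' := T0 + (L + 1)^-1.
have TT' : T0 < T' by rewrite ltrDl invr_gt0 ltr_wpDl.
pose W t x := if x \in S then if t < T0 then u x t else w (t - T0) x else 0.
have WT0 x : W T0 x = a x.
  by rewrite /W ltxx subrr w0 /a; case: (x \in S).
have Wu x t : x \in S -> t < T0 -> W t x = u x t.
  by move=> xS tT; rewrite /W xS tT.
have Ww x t : x \in S -> T0 <= t -> W t x = w (t - T0) x.
  by move=> xS tT; rewrite /W xS ltNge tT.
have aK x : `|a x| <= Num.max K 0.
  rewrite /a; case: ifP => [xS|_]; last by rewrite normr0.
  by have [/andP[? ?] _] := lP x xS; rewrite ger0_norm.
have wM x r : 0 <= r -> r < (L + 1)^-1 -> `|w r x| <= M.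
  move=> r0 rL; have := wL 0 r x (lexx _) r0; rewrite w0 subr0 (ger0_norm r0).
  have : L * r <= 1.
    apply: le_trans (_ : (L + 1) * (L + 1)^-1 <= _).
      by apply: ler_pM => //; [rewrite lerDl|exact: ltW].
    by rewrite mulfV// gt_eqF// ltr_wpDl.
  move=> Lr wa; rewrite -[w r x](subrK (a x)).
  by apply: le_trans (ler_normD _ _) _; rewrite /M addrC lerD// (le_trans wa).
have uM x t : x \in S -> 0 <= t -> t < T0 -> `|u x t| <= M.
  move=> xS t0 tT; rewrite ger0_norm; last by rewrite solution_ge0 ?Ssb ?before.
  by apply: le_trans (uK x t xS t0 tT) _; rewrite /M ler_wpDr// le_max lexx.
have WM x t : 0 <= t -> t < T' -> `|W t x| <= M.
  move=> t0 tT'; rewrite /W; case: ifP => xS; last by rewrite normr0.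
  have [tT|tT] := ltP t T0; first exact: uM.
  by apply: wM; rewrite ?subr_ge0// ltrBlDl.
have truncW t x : x \in S -> 0 <= t -> t < T' ->
    truncated M (W t) x = field (W t) x.
  move=> xS t0 tT'; rewrite /truncated xS; apply: field_eq => // y yS.
  by rewrite clip_id// WM.
have truncw t x : x \in S -> T0 <= t -> t < T' ->
    truncated M (w (t - T0)) x = field (W t) x.
  move=> xS tT tT'; rewrite /truncated xS; apply: field_eq => // y yS.
  by rewrite clip_id ?Ww// wM ?subr_ge0// ltrBlDl.
pose v x t := extend (W t) x.
have vu x t : x \in sbar G S -> 0 <= t -> t < T0 -> v x t = u x t.
  move=> xs t0 tT; rewrite /v (@extend_eq (W t) (u ^~ t)); last first.
    by move=> y yS; exact: Wu.
  move: xs; rewrite mem_sbar => /orP[xS|xb]; first by rewrite /extend xS.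
  by rewrite -sol_extend// before.
(* The left half of the differentiability of W at T0; [dW] joins it with the
   right half. *)
have leftW x : x \in S -> forall e, 0 < e -> exists2 d, 0 < d &
    forall s, 0 < s < T0 -> T0 - s < d ->
    `|W T0 x - W s x - (T0 - s) * field (W T0) x| <= e * (T0 - s).
  move=> xS; have [_ ul] := lP x xS.
  have Wleft z : W t z @[t --> T0^'-] --> W T0 z.
    rewrite WT0 /a; case: ifPn => zS.
      have [_] := lP z zS; apply: cvg_trans; apply: near_eq_cvg; near=> t.
      by rewrite Wu//; near: t; exact: nbhs_left_lt.
    apply: (@cvg_trans _ (cst 0 @ T0^'-)); last exact: cvg_cst.
    by apply: near_eq_cvg; near=> t; rewrite /W (negbTE zS).
  apply: (@left_increment _ (W ^~ x) (derive1 (u x)) 0 T0) => //.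
  - move=> t /andP[t0 tT].
    have D1 : is_derive t 1 (u x) (derive1 (u x) t).
      rewrite derive1E; apply/derivableP/(sol_derivable sol) => //.
        exact: Ssb.
      exact: before.
    apply: near_eq_is_derive D1; near=> s; rewrite Wu//.
    by near: s; exact: lt_nbhsl.
  - rewrite -truncW// ?(ltW T0_gt0)//; apply: cvg_trans (_ : truncated M (W t) x @[t --> T0^'-] --> _); last first.
      rewrite /truncated xS; apply: field_cvg => // z; apply: clip_cvg; exact: Wleft.
    apply: near_eq_cvg; near=> t.
    have t0 : 0 < t by near: t; exact: nbhs_left_gt.
    have tT : t < T0 by near: t; exact: nbhs_left_lt.
    rewrite truncW ?(ltW t0) ?(lt_trans tT)// solution_field ?before//.
    by apply: field_eq => // y yS; rewrite Wu.
have dW x t : x \in S -> T0 <= t -> t < T' ->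
    is_derive t 1 (W ^~ x) (field (W t) x).
  move=> xS T0t tT'; apply: increment_is_derive => e e0.
  have r0 : 0 <= t - T0 by rewrite subr_ge0.
  have [d1 d10 H1] := wF (t - T0) x e r0 e0.
  rewrite truncw// in H1.
  have right h : T0 <= h + t -> `|h| < d1 ->
      `|W (h + t) x - W t x - h * field (W t) x| <= e * `|h|.
    move=> T0h hd; rewrite !Ww//.
    have hT0 : 0 <= h + t - T0 by rewrite subr_ge0.
    have E1 : h + t - T0 - (t - T0) = h by ring.
    have E2 : t - T0 - (h + t - T0) = - h by ring.
    have [h0|h0] := leP 0 h.
      rewrite (ger0_norm h0) in hd *; have := H1 (t - T0) (h + t - T0) r0.
      by rewrite E1 subrr normr0 (ger0_norm h0); apply => //; lra.
    have := H1 (h + t - T0) (t - T0) hT0.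
    rewrite (ltr0_norm h0) in hd *.
    rewrite E1 E2 subrr normr0 (ltr0_norm h0) mulNr opprK => H.
    have -> : w (h + t - T0) x - w (t - T0) x - h * field (W t) x
      = - (w (t - T0) x - w (h + t - T0) x + h * field (W t) x) by ring.
    by rewrite normrN; apply: H => //; lra.
  move: T0t; rewrite le_eqVlt => /predU1P[tE|T0t].
    have [d2 d20 H2] := leftW x xS e e0.
    exists (Num.min T0 (Num.min d1 d2)); first by rewrite !lt_min T0_gt0 d10 d20.
    move=> h; rewrite !lt_min => /and3P[hT hd1 hd2].
    have [h0|h0] := leP 0 h; first by apply: right => //; rewrite tE lerDr.
    move: hT hd1 hd2; rewrite (ltr0_norm h0) => hT hd1 hd2.
    rewrite -tE; have H := H2 (h + T0).
    have E2 : T0 - (h + T0) = - h by ring.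
    rewrite E2 mulNr opprK in H.
    have -> : W (h + T0) x - W T0 x - h * field (W T0) x
      = - (W T0 x - W (h + T0) x + h * field (W T0) x) by ring.
    by rewrite normrN; apply: H => //; lra.
  exists (Num.min d1 (t - T0)); first by rewrite lt_min d10 subr_gt0.
  move=> h; rewrite lt_min => /andP[hd1 hT]; apply: right => //.
  by move: hT; rewrite ltr_norml => /andP[? ?]; lra.
(* Before T0 differentiability is inherited from u, also at the boundary. *)
have dv x t : x \in sbar G S -> 0 < t -> t < T' -> derivable (v x) t 1.
  move=> xs t0 tT'; have [tT|T0t] := ltP t T0.
    have D1 : derivable (u x) t 1 by apply: (sol_derivable sol) => //; exact: before.
    apply: near_eq_derivable D1; near=> s; rewrite vu//.
      by apply/ltW; near: s; exact: lt_nbhsr.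
    by near: s; exact: lt_nbhsl.
  have dWx y : y \in S -> derivable (W ^~ y) t 1.
    by move=> yS; have [] := dW y t yS T0t tT'.
  have [xS|xS] := boolP (x \in S).
    rewrite (_ : v x = W ^~ x); first exact: dWx.
    by apply/funext => s; rewrite /v /extend xS.
  rewrite (_ : v x = fun s => pmean p (bweight x) (bval (W s))); last first.
    by apply/funext => s; rewrite /v /extend (negbTE xS).
  apply: pmean_derivable => //.
    by apply: bweight_nontrivial; move: xs; rewrite mem_sbar (negbTE xS).
  move=> y; have [yS|yS] := boolP (y \in S).
    rewrite (_ : (fun s => _) = W ^~ y); first exact: dWx.
    by apply/funext => s; rewrite /bval yS.
  rewrite (_ : (fun s => _) = cst 0); first exact: derivable_cst.
  by apply/funext => s; rewrite /bval (negbTE yS).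
exists T'%:E, v; split; [by rewrite TE lte_fin| |by move=> x xs t; exact: vu].
split.
- by rewrite lte_fin (lt_trans T0_gt0).
- move=> x xs; apply/within_continuousP => t [t0]; rewrite lte_fin => tT' e e0.
  (* For t > 0 continuity follows from differentiability; at t = 0 it is that
     of u. *)
  move: t0; rewrite le_eqVlt => /predU1P[<-|t0].
    have cu := (within_continuousP _ _).1 (sol_continuous sol xs).
    have in0 : [set s : R | 0 <= s /\ (s%:E < T)%E] 0 by split => //; exact: before.
    have [d d0 Hd] := cu 0 in0 e e0.
    exists (Num.min d T0); first by rewrite lt_min d0.
    move=> s [s0 _]; rewrite lt_min subr0 ger0_norm// => /andP[sd sT].
    by rewrite !vu//; apply: Hd; rewrite ?subr0 ?ger0_norm//; split => //; exact: before.
  have : {for t, continuous (v x)}.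
    by apply: differentiable_continuous; apply/derivable1_diffP; exact: dv.
  move/cvgrPdist_lt => /(_ e e0) /nbhs_ballP[d /= d0 Hd]; exists d => // s _ st.
  by rewrite distrC; apply: Hd; rewrite /ball/= distrC.
- by move=> x xs t t0; rewrite lte_fin; exact: dv.
- move=> x xS t t0; rewrite lte_fin => tT'; rewrite reactionE.
  have -> : p_laplacian G S p (v ^~ t) x + lambda * ppow (q + 1) (v x t)
      = field (W t) x.
    by rewrite /field {2}/v /extend xS.
  have [tT|T0t] := ltP t T0.
    transitivity (derive1 (u x) t).
      rewrite !derive1E; apply: near_eq_derive => //; near=> s; rewrite vu ?Ssb//.
        by apply/ltW; near: s; exact: lt_nbhsr.
      by near: s; exact: lt_nbhsl.
    rewrite solution_field ?before//; apply: field_eq => // y yS.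
    by rewrite Wu.
  rewrite (_ : v x = W ^~ x); last by apply/funext => s; rewrite /v /extend xS.
  by rewrite derive1E; have [_ ->] := dW x t xS T0t tT'.
- by move=> z zb t _ _; exact: extend_boundary.
- by move=> x xs; rewrite vu// (sol_initial sol).
Unshelve. all: by end_near. Qed.

Lemma maximal_solution_blows_up : threshold < max_over S u0 ->
  (forall (T' : \bar R) (v : V -> R -> R),
     is_solution G S p q lambda mu sigma u0 T' v ->
     (forall x, x \in sbar G S ->
        forall t, 0 <= t -> (t%:E < T)%E -> (t%:E < T')%E -> v x t = u x t) ->
     (T' <= T)%E) ->
  exists2 T0 : R, T = T0%:E & blows_up_at S T0 u.
Proof.
move=> u0max maximal.
have [x0 x0S x0u] : exists2 x, x \in S & threshold < u0 x.
  apply: contrapT => H; move: u0max; apply/negP; rewrite -leNgt.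
  apply: bigmax_le; first exact: powR_ge0.
  by move=> x xS; rewrite leNgt; apply/negP => ux; apply: H; exists x.
have [B TB] := solution_lifetime x0S x0u.
have [T0 TE] : exists T0 : R, T = T0%:E.
  have : (T != +oo)%E.
    apply/eqP => TE; have := TB (Num.max B 0 + 1).
    rewrite TE ltry addr_ge0 ?le_max ?lexx ?orbT// => /(_ isT isT).
    by rewrite leNgt ltr_pwDr// le_max lexx.
  by have := sol_time_gt0 sol; case: T => [r|//|//] _ _; exists r.
exists T0 => //; split; first by rewrite -lte_fin -TE; exact: (sol_time_gt0 sol).
apply: contrapT => noblow.
have [K _ uK] : exists2 K, 0 <= K &
    forall x t, x \in S -> `[0, T0[%classic t -> u x t <= K.
  apply: finite_bound => x xS; apply: contrapT => unb; apply: noblow.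
  exists x => //; apply: unbounded_blows_up => // K; apply: contrapT => H.
  apply: unb; exists K => t; rewrite /= in_itv/= => /andP[t0 tT].
  by rewrite leNgt; apply/negP => Ku; apply: H; exists t.
have [|T' [v [TT' solv vu]]] := @bounded_solution_extends T0 K TE.
  by move=> x t xS t0 tT; apply: uK => //; rewrite /= in_itv/= t0.
have : (T' <= T)%E.
  by apply: (maximal T' v) => // x xs t t0 tT _; apply: vu => //; rewrite -lte_fin -TE.
by rewrite leNgt TT'.
Qed.

End Solution.
End Network.

Theorem theorem3p5 (R : realType) (V : finType) (G : network R V)
    (S : {set V}) (hS : connected_subgraph G S)
    (p q lambda : R) (mu sigma u0 : V -> R)
    (hmu : forall z, z \in bdry G S -> 0 <= mu z)
    (hsigma : forall z, z \in bdry G S -> 0 <= sigma z)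
    (hmusigma : forall z, z \in bdry G S -> 0 < mu z + sigma z)
    (hlambda : 0 < lambda) (hp : 0 < p - 1) (hpq : p - 1 < q) (hq : 1 < q)
    (hsigma0 : exists2 z, z \in bdry G S & sigma z != 0)
    (hu0 : forall x, x \in sbar G S -> 0 <= u0 x)
    (hmax : (max_over S (degree G S) / lambda) `^ ((q - p + 1)^-1)
            < max_over S u0)
    (T : \bar R) (u : V -> R -> R)
    (hu : is_maximal_solution G S p q lambda mu sigma u0 T u) :
  exists2 T0 : R, T = T0%:E & blows_up_at S T0 u.
Proof.
have [sol maximal] := hu.
have p1 : 1 < p by rewrite -subr_gt0.
exact: (maximal_solution_blows_up hmu hsigma hmusigma hlambda p1 hpq hq sol hu0).
Qed.
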